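(* (Linear Reconstruction Theorem.) For $i=1,2$ let $(L_i,G_i)$ be a linear permutation group which is 2-interval-transitive and has a nonidentity bounded element. (1) If $G_1\equiv G_2$ (elementarily equivalent as groups), then $\mathrm{ACT}(\mathrm{EP}(L_1,G_1),G_1)\equiv \mathrm{ACT}(\mathrm{EP}(L_2,G_2),G_2)$. (2) If $\alpha:G_1\to G_2$ is a group isomorphism, then there exists a unique monotonic bijection $\tau:\bar L_1\to\bar L_2$ which induces $\alpha$, i.e. $\alpha(g)=\tau\circ g\circ\tau^{-1}$ for all $g\in G_1$.
   Context: A chain $L$ is a dense linearly ordered set without endpoints (with more than one element); $\mathrm{Aut}(L)$ is its group of order-preserving bijections. $\bar L$ is the Dedekind completion of $L$ without endpoints (no endpoints are added); every $g\in\mathrm{Aut}(L)$ extends uniquely to an order-preserving bijection of $\bar L$, again denoted $g$. An $L$-interval is a nonempty open interval $(x,y)=\{z\in L:x<z<y\}$ ($x<y$ in $L$), a ray $(-\infty,x)$ or $(x,\infty)$, or $L$ itself; it is bounded if of the form $(x,y)$. For sets, $I<J$ means every element of $I$ is below every element of $J$ (and both are nonempty). A linear permutation group is a pair $(L,G)$ with $G\le\mathrm{Aut}(L)$. For $g\in G$, $\mathrm{supp}(g)=\{x\in\bar L: g(x)\ne x\}$; $g$ is bounded if $\mathrm{supp}(g)$ is contained in a bounded interval of $\bar L$. $(L,G)$ is 2-interval-transitive if for all $L$-intervals $I_1<I_2$ and $J_1<J_2$ there is $g\in G$ with $g(I_1)\cap J_1\neq\emptyset$ and $g(I_2)\cap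 J_2\neq\emptyset$. A bijection between chains is monotonic if it either preserves or reverses order. For $g\in G$ let $\mathrm{var}(g)$ be the interior of the closure of $\mathrm{supp}(g)$ in $\bar L$ (order topology), and let $\mathrm{Ep}(g)$ be the set of endpoints in $\bar L$ (infimum and/or supremum, when they exist in $\bar L$) of the convex hull of $\mathrm{var}(g)$. Put $\mathrm{Ep}(L,G)=\bigcup_{g\in G}\mathrm{Ep}(g)$, a $G$-invariant subset of $\bar L$, and let $\mathrm{EP}(L,G)$ be the structure $(\mathrm{Ep}(L,G),\mathrm{Ed})$ where $\mathrm{Ed}(x_1,x_2,y_1,y_2)$ holds iff ($x_1<x_2$ and $y_1<y_2$) or ($x_1>x_2$ and $y_1>y_2$). For a structure $M$ and $H\le\mathrm{Aut}(M)$, $\mathrm{ACT}(M,H)$ is the two-sorted structure with universe $|M|\cup H$, with the relations of $M$, the group multiplication on $H$, the application function $\mathrm{Ap}(h,x)=h(x)$, and unary predicates distinguishing the two sorts. *)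

(* Defs.v *)
From HB Require Import structures.
From mathcomp Require Import all_boot all_order.
From mathcomp Require Import interval boolp classical_sets set_interval topology.

Set Implicit Arguments.
Unset Strict Implicit.
Unset Printing Implicit Defensive.

Import Order.TTheory.
Local Open Scope classical_set_scope.
Local Open Scope order_scope.
Local Open Scope group_scope.

Record signature := Signature {
  fun_sym : Type;
  fun_arity : fun_sym -> nat;
  rel_sym : Type;
  rel_arity : rel_sym -> nat
}.
Arguments fun_arity : clear implicits.
Arguments rel_arity : clear implicits.

Record structure (S : signature) := Structure {
  dom :> Type;
  fun_itp : forall f : fun_sym S, ('I_(fun_arity S f) -> dom) -> dom;
  rel_itp : forall r : rel_sym S, ('I_(rel_arity S r) -> dom) -> Prop
}.
Arguments fun_itp {S} s f v.
Arguments rel_itp {S} s r v.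

(* [term S n] and [formula S n] have their free variables in ['I_n];
   a quantifier binds the variable of index [ord0] of its body. *)
Inductive term (S : signature) (n : nat) : Type :=
| Var of 'I_n
| App (f : fun_sym S) (a : 'I_(fun_arity S f) -> term S n).

Inductive formula (S : signature) : nat -> Type :=
| FEq n of term S n & term S n : formula S n
| FRel n (r : rel_sym S) (a : 'I_(rel_arity S r) -> term S n) : formula S n
| FFalse n : formula S n
| FAnd n of formula S n & formula S n : formula S n
| FOr n of formula S n & formula S n : formula S n
| FImp n of formula S n & formula S n : formula S n
| FAll n of formula S n.+1 : formula S n
| FEx n of formula S n.+1 : formula S n.

Fixpoint eval S (M : structure S) n (v : 'I_n -> M) (t : term S n) : M :=
  match t with
  | Var i => v i
  | App f a => fun_itp M f (fun i => eval v (a i))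
  end.

Definition extend (T : Type) n (x : T) (v : 'I_n -> T) : 'I_n.+1 -> T :=
  fun i => oapp v x (unlift ord0 i).

Fixpoint holds S (M : structure S) n (p : formula S n) : ('I_n -> M) -> Prop :=
  match p in formula _ n return ('I_n -> M) -> Prop with
  | FEq _ t u => fun v => eval v t = eval v u
  | FRel _ r a => fun v => rel_itp M r (fun i => eval v (a i))
  | FFalse _ => fun=> False
  | FAnd _ p q => fun v => holds p v /\ holds q v
  | FOr _ p q => fun v => holds p v \/ holds q v
  | FImp _ p q => fun v => holds p v -> holds q v
  | FAll _ p => fun v => forall x : M, holds p (extend x v)
  | FEx _ p => fun v => exists x : M, holds p (extend x v)
  end.

Definition elem_equiv S (M N : structure S) : Prop :=
  forall (p : formula S 0) (v : 'I_0 -> M) (w : 'I_0 -> N),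
    holds p v <-> holds p w.

Definition relational (R : Type) (arity : R -> nat) : signature :=
  @Signature void (fun=> 0) R arity.

Definition arg (T : Type) n (v : 'I_n -> T) i (lt_i_n : (i < n)%N) : T :=
  v (Ordinal lt_i_n).

Local Notation "v .# i" := (@arg _ _ v i isT)
  (at level 2, i at level 0, left associativity, format "v .# i").

Variant group_sym := GMul | GInv | GOne.

Definition group_arity (f : group_sym) : nat :=
  match f with GMul => 2 | GInv => 1 | GOne => 0 end.

Definition group_sig : signature :=
  @Signature group_sym group_arity void (fun=> 0).

Definition group_structure (H : groupType) : structure group_sig :=
  @Structure group_sig H
    (fun f => match f return ('I_(group_arity f) -> H) -> H with
     | GMul => fun v => v.#0 * v.#1
     | GInv => fun v => (v.#0)^-1
     | GOne => fun=> 1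
     end)
    (fun r => match r with end).

(* The universe of ACT(M, H) is the disjoint union of |M| and H; the group
   multiplication and the application, which are partial operations on it,
   are given by their graphs. *)
Variant act_sym (R : Type) :=
  ActRel of R | ActMul | ActAp | ActPoint | ActGroup.

Arguments ActMul {R}.
Arguments ActAp {R}.
Arguments ActPoint {R}.
Arguments ActGroup {R}.

Definition act_arity (R : Type) (arity : R -> nat) (r : act_sym R) : nat :=
  match r with
  | ActRel r => arity r
  | ActMul => 3
  | ActAp => 3
  | ActPoint => 1
  | ActGroup => 1
  end.

Definition ACT (R : Type) (arity : R -> nat)
    (M : structure (relational arity)) (H : groupType) (ap : H -> M -> M) :
    structure (relational (act_arity arity)) :=
  @Structure (relational (act_arity arity)) (M + H)%type
    (fun f => match f with end)
    (fun r =>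
       match r return ('I_(act_arity arity r) -> M + H) -> Prop with
       | ActRel r => fun v =>
           exists2 w, (forall i, v i = inl (w i)) & rel_itp M r w
       | ActMul => fun v => exists g h : H,
           [/\ v.#0 = inr g, v.#1 = inr h & v.#2 = inr (g * h)]
       | ActAp => fun v => exists (h : H) (x : M),
           [/\ v.#0 = inr h, v.#1 = inl x & v.#2 = inl (ap h x)]
       | ActPoint => fun v => exists x : M, v.#0 = inl x
       | ActGroup => fun v => exists h : H, v.#0 = inr h
       end).

HB.mixin Record Order_isChain d T & Order.Total d T := {
  chain_dense : forall x y : T, x < y -> exists z, x < z < y;
  chain_nomin : forall x : T, exists y, y < x;
  chain_nomax : forall x : T, exists y, x < y;
  chain_nontrivial : exists x y : T, x != y
}.

#[short(type="chainType")]
HB.structure Definition Chain d := {T of Order.Total d T & Order_isChain d T}.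

Definition order_aut d (L : chainType d) (f : L -> L) : Prop :=
  bijective f /\ {mono f : x y / x <= y}.

Definition Aut d (L : chainType d) : Type := {f : L -> L | `[< order_aut f >]}.

Definition mk_aut d (L : chainType d) (f : L -> L) (hf : order_aut f) : Aut L :=
  exist (fun f => is_true `[< order_aut f >]) f (asboolT hf).

Definition aut_fun d (L : chainType d) (g : Aut L) : L -> L := val g.
Coercion aut_fun : Aut >-> Funclass.

Section AutGroup.
Context d (L : chainType d).

HB.instance Definition _ := SubChoice.on (Aut L).

Lemma autP (g : Aut L) : order_aut g.
Proof. exact/asboolP/(valP g). Qed.

Lemma aut_mono (g : Aut L) : {mono g : x y / x <= y}.
Proof. by case: (autP g). Qed.

Lemma eq_aut (g h : Aut L) : g =1 h -> g = h.
Proof. by move=> gh; apply/val_inj/funext. Qed.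

Lemma aut_one_subproof : order_aut (@id L).
Proof. by split => //; exists id. Qed.

Lemma aut_mul_subproof (g h : Aut L) : order_aut (g \o h).
Proof.
split; first by apply: bij_comp; [case: (autP g)|case: (autP h)].
by move=> x y /=; rewrite !aut_mono.
Qed.

Lemma aut_inv_subproof (g : Aut L) :
  { h : L -> L | cancel g h /\ cancel h g }.
Proof. by apply: cid; case: (autP g) => -[h gh hg] _; exists h. Qed.

Definition aut_inv_fun (g : Aut L) : L -> L := sval (aut_inv_subproof g).

Lemma aut_funK (g : Aut L) : cancel g (aut_inv_fun g).
Proof. by case: (svalP (aut_inv_subproof g)). Qed.

Lemma aut_inv_funK (g : Aut L) : cancel (aut_inv_fun g) g.
Proof. by case: (svalP (aut_inv_subproof g)). Qed.

Lemma aut_inv_order (g : Aut L) : order_aut (aut_inv_fun g).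
Proof.
split.
  by exists g; [exact: aut_inv_funK|exact: aut_funK].
by move=> x y; rewrite -(aut_mono g) !aut_inv_funK.
Qed.

Definition aut_one : Aut L := mk_aut aut_one_subproof.
Definition aut_mul (g h : Aut L) : Aut L := mk_aut (aut_mul_subproof g h).
Definition aut_inv (g : Aut L) : Aut L := mk_aut (aut_inv_order g).

Lemma aut_mulA : associative aut_mul.
Proof. by move=> f g h; exact: eq_aut. Qed.
Lemma aut_mul1g : left_id aut_one aut_mul.
Proof. by move=> g; exact: eq_aut. Qed.
Lemma aut_mulg1 : right_id aut_one aut_mul.
Proof. by move=> g; exact: eq_aut. Qed.
Lemma aut_mulVg : left_inverse aut_one aut_inv aut_mul.
Proof. by move=> g; apply: eq_aut => x; exact: aut_funK. Qed.
Lemma aut_mulgV : right_inverse aut_one aut_inv aut_mul.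
Proof. by move=> g; apply: eq_aut => x; exact: aut_inv_funK. Qed.

(* Automorphisms act on the left: (g * h) x = g (h x), whereas permutations
   in the library's [perm] compose in the opposite order. *)
HB.instance Definition _ := isGroup.Build (Aut L)
  aut_mulA aut_mul1g aut_mulg1 aut_mulVg aut_mulgV.

End AutGroup.

(* A linear permutation group on L is a [G : groupClosed (Aut L)], i.e.
   a subgroup of Aut(L); [elt G] is G as a group in its own right. *)
Definition elt d (L : chainType d) (G : groupClosed (Aut L)) : Type :=
  {g : Aut L | g \in G}.

Section Elt.
Context d (L : chainType d) (G : groupClosed (Aut L)).

Lemma elt_group_closed : group_closed (mem G).
Proof. by split; [exact: gpred1|exact: gpredF]. Qed.

HB.instance Definition _ := SubChoice.on (elt G).
HB.instance Definition _ :=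
  SubChoice_isSubGroup.Build (Aut L) (mem G) (elt G) elt_group_closed.

End Elt.

(* The points of the Dedekind completion are the lower parts A of the cuts,
   normalized to have no maximum; neither A nor its complement is empty, so
   that no endpoint is added. A point x of L becomes [set z | z < x]. *)
Definition is_cut d (L : chainType d) (A : set L) : Prop :=
  [/\ A !=set0, ~` A !=set0,
      forall x y, x <= y -> A y -> A x &
      forall x, A x -> exists2 y, A y & x < y].

Definition dedekind d (L : chainType d) : Type := {A : set L | `[< is_cut A >]}.

Definition mk_cut d (L : chainType d) (A : set L) (hA : is_cut A) : dedekind L :=
  exist (fun A => is_true `[< is_cut A >]) A (asboolT hA).

Section Dedekind.
Context d (L : chainType d).
Implicit Types a b : dedekind L.

HB.instance Definition _ := SubChoice.on (dedekind L).

Definition lower_part a : set L := val a.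

Lemma cutP a : is_cut (lower_part a).
Proof. exact/asboolP/(valP a). Qed.

Definition dedekind_le a b : bool := `[< lower_part a `<=` lower_part b >].

Lemma dedekind_le_refl : reflexive dedekind_le.
Proof. by move=> a; exact/asboolP. Qed.

Lemma dedekind_le_anti : antisymmetric dedekind_le.
Proof.
move=> a b /andP[/asboolP ab /asboolP ba]; apply/val_inj.
by rewrite eqEsubset.
Qed.

Lemma dedekind_le_trans : transitive dedekind_le.
Proof.
move=> b a c /asboolP ab /asboolP bc; apply/asboolP.
exact: (subset_trans ab bc).
Qed.

HB.instance Definition _ := Order.Le_isPOrder.Build d (dedekind L)
  dedekind_le_refl dedekind_le_anti dedekind_le_trans.

Lemma dedekind_leP a b : reflect (lower_part a `<=` lower_part b) (a <= b).
Proof. exact: asboolP. Qed.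

Lemma dedekind_le_total : total (<=%O : rel (dedekind L)).
Proof.
move=> a b; apply/orP; have [ab|/existsNP[x /not_implyP[ax bx]]] :=
  pselect (lower_part a `<=` lower_part b); first by left; apply/dedekind_leP.
right; apply/dedekind_leP => y yb; have [_ _ da _] := cutP a.
have [_ _ db _] := cutP b.
by apply: da ax; case: (leP y x) => // /ltW /db /(_ yb).
Qed.

HB.instance Definition _ :=
  Order.POrder_isTotal.Build d (dedekind L) dedekind_le_total.

HB.instance Definition _ :=
  OrderTopological.copy (dedekind L) (order_topology (dedekind L)).

Lemma embed_subproof (x : L) : is_cut [set z | z < x].
Proof.
split.
- by have [y yx] := chain_nomin x; exists y.
- by exists x; rewrite /= ltxx.
- by move=> y z /= /le_lt_trans; apply.
- by move=> y /= /chain_dense[z /andP[yz zx]]; exists z.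
Qed.

Definition embed (x : L) : dedekind L := mk_cut (embed_subproof x).

Lemma embed_mono : {mono embed : x y / x <= y}.
Proof.
move=> x y; apply/dedekind_leP/idP => [|xy z /= zx].
  by rewrite leNgt => xy; apply/negP => /xy; rewrite /lower_part /= ltxx.
exact: lt_le_trans xy.
Qed.

Lemma mem_lower_part (x : L) a : lower_part a x <-> embed x < a.
Proof.
rewrite ltNge; have [_ _ da ma] := cutP a; split=> [ax|/negP ax].
  by apply/negP => /dedekind_leP/(_ _ ax); rewrite /lower_part /= ltxx.
apply: contrapT => nax; apply: ax; apply/dedekind_leP => y ay.
by rewrite /lower_part /= ltNge; apply/negP => xy; apply: nax; exact: da ay.
Qed.

Lemma embed_dense a b : a < b -> exists x, a < embed x < b.
Proof.
rewrite ltNge => /negP nba.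
have [x bx nax] : exists2 x, lower_part b x & ~ lower_part a x.
  apply: contrapT => nex; apply: nba; apply/dedekind_leP => x bx.
  by apply: contrapT => nax; apply: nex; exists x.
have [_ _ _ mb] := cutP b; have [y b_y xy] := mb _ bx.
exists y; apply/andP; split; last exact/mem_lower_part.
apply: le_lt_trans (_ : embed x < embed y); last by rewrite (leW_mono embed_mono).
by rewrite leNgt; apply/negP => /mem_lower_part.
Qed.

Lemma dedekind_noends a : exists x y, embed x < a < embed y.
Proof.
have [[x ax] [z naz] _ _] := cutP a; have [y zy] := chain_nomax z.
exists x, y; apply/andP; split; first exact/mem_lower_part.
apply: le_lt_trans (_ : embed z < _); last by rewrite (leW_mono embed_mono).
by rewrite leNgt; apply/negP => /mem_lower_part.
Qed.

Lemma dedekind_complete (X : set (dedekind L)) :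
  has_sup X -> supremums X !=set0.
Proof.
move=> [[a Xa] [b Xb]]; pose A := \bigcup_(c in X) lower_part c.
have cA : is_cut A.
  split.
  - by have [[x ax] _ _ _] := cutP a; exists x, a.
  - have [_ [x nbx] _ _] := cutP b; exists x => -[c Xc cx]; apply: nbx.
    by have /dedekind_leP := Xb _ Xc; apply.
  - move=> x y xy [c Xc cy]; exists c => //; have [_ _ dc _] := cutP c.
    exact: dc cy.
  - move=> x [c Xc cx]; have [_ _ _ mc] := cutP c.
    by have [y cy xy] := mc _ cx; exists y => //; exists c.
exists (mk_cut cA); split=> [c Xc|c ubc]; apply/dedekind_leP => x.
  by move=> cx; exists c.
by move=> [c' /ubc /dedekind_leP]; apply.
Qed.

Lemma ext_subproof (g : Aut L) a : is_cut (g @` lower_part a).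
Proof.
have gE x : x = g (aut_inv_fun g x) by rewrite aut_inv_funK.
have gI : injective g := can_inj (aut_funK g).
have [[x ax] [y nay] da ma] := cutP a; split.
- by exists (g x), x.
- by exists (g y) => -[z az] /gI zy; apply: nay; rewrite -zy.
- move=> p q pq [z az zq]; exists (aut_inv_fun g p); last exact: aut_inv_funK.
  by apply: da az; rewrite -(aut_mono g) -gE zq.
- move=> _ [z az <-]; have [t at_ zt] := ma _ az.
  by exists (g t); [exists t|rewrite (leW_mono (@aut_mono _ _ g))].
Qed.

(* The order-preserving extension of g to the Dedekind completion. *)
Definition ext (g : Aut L) a : dedekind L := mk_cut (ext_subproof g a).

Lemma ext_embed (g : Aut L) (x : L) : ext g (embed x) = embed (g x).
Proof.
apply/val_inj; rewrite /= eqEsubset; split=> [_ [z zx <-]|z zgx].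
  by rewrite /= (leW_mono (@aut_mono _ _ g)).
exists (aut_inv_fun g z); last exact: aut_inv_funK.
by rewrite /lower_part /= -(leW_mono (@aut_mono _ _ g)) aut_inv_funK.
Qed.

Lemma ext1 a : ext 1 a = a.
Proof. by apply/val_inj; rewrite /= image_id. Qed.

Lemma extM (g h : Aut L) a : ext (g * h) a = ext g (ext h a).
Proof. by apply/val_inj; rewrite /= image_comp. Qed.

Lemma extK (g : Aut L) : cancel (ext g) (ext g^-1).
Proof. by move=> a; rewrite -extM mulVg ext1. Qed.

Lemma extVK (g : Aut L) : cancel (ext g^-1) (ext g).
Proof. by move=> a; rewrite -extM mulgV ext1. Qed.

Lemma ext_mono (g : Aut L) : {mono ext g : a b / a <= b}.
Proof.
have hom (h : Aut L) a b : a <= b -> ext h a <= ext h b.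
  by move=> /dedekind_leP ab; apply/dedekind_leP; exact: image_subset.
by move=> a b; apply/idP/idP => /hom; [move=> /(_ g^-1); rewrite !extK|apply].
Qed.

Lemma ext_unique (g : Aut L) (f : dedekind L -> dedekind L) :
  {mono f : a b / a <= b} -> (forall x, f (embed x) = embed (g x)) -> f = ext g.
Proof.
move=> fm fe; apply/funext => a.
have lt_f x : (embed (g x) < f a) = (embed x < a).
  by rewrite -fe (leW_mono fm).
have lt_g x : (embed (g x) < ext g a) = (embed x < a).
  by rewrite -ext_embed (leW_mono (ext_mono g)).
have E y : lower_part (f a) y <-> lower_part (ext g a) y.
  rewrite -[y](aut_inv_funK g).
  by split=> /mem_lower_part; rewrite ?lt_f ?lt_g => ya;
    apply/mem_lower_part; rewrite ?lt_f ?lt_g.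
by apply/val_inj/funext => y; exact/propext/E.
Qed.

Definition supp (g : Aut L) : set (dedekind L) := [set a | ext g a <> a].

Definition bounded_aut (g : Aut L) : Prop :=
  exists a b, a < b /\ supp g `<=` [set` `]a, b[].

Definition var (g : Aut L) : set (dedekind L) := (closure (supp g))°.

Definition convex_hull (X : set (dedekind L)) : set (dedekind L) :=
  [set c | exists a b, [/\ X a, X b & a <= c <= b]].

Definition Ep (g : Aut L) : set (dedekind L) :=
  infimums (convex_hull (var g)) `|` supremums (convex_hull (var g)).

End Dedekind.

Section Intervals.
Context d (L : chainType d).

Definition L_interval (I : set L) : Prop :=
  [\/ exists x y, x < y /\ I = [set` `]x, y[],
      exists x, I = [set` `]-oo, x[],
      exists x, I = [set` `]x, +oo[] |
      I = setT].

Definition set_lt (I J : set L) : Prop :=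
  [/\ I !=set0, J !=set0 & forall x y, I x -> J y -> x < y].

Definition two_interval_transitive (G : groupClosed (Aut L)) : Prop :=
  forall I1 I2 J1 J2 : set L,
    L_interval I1 -> L_interval I2 -> L_interval J1 -> L_interval J2 ->
    set_lt I1 I2 -> set_lt J1 J2 ->
    exists g : Aut L, [/\ g \in G,
      (g @` I1) `&` J1 !=set0 & (g @` I2) `&` J2 !=set0].

Definition has_bounded_element (G : groupClosed (Aut L)) : Prop :=
  exists g : Aut L, [/\ g \in G, g != 1 & bounded_aut g].

End Intervals.

Section Conjugation.
Context d (L : chainType d) (g : Aut L).
Implicit Types X Y : set (dedekind L).

Lemma ext_continuous (k : Aut L) : continuous (ext k).
Proof.
move=> a U; rewrite /= nbhs_simpl itv_nbhsE => -[i [oi ai] iU].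
rewrite /= itv_nbhsE.
pose m (b : itv_bound (dedekind L)) :=
  match b with BSide s x => BSide s (ext k^-1 x) | BInfty s => BInfty _ s end.
have lek x y : (ext k^-1 x <= y) = (x <= ext k y).
  by rewrite -(ext_mono k) extVK.
have ltk x y : (ext k^-1 x < y) = (x < ext k y).
  by rewrite -(leW_mono (ext_mono k)) extVK.
have kle x y : (y <= ext k^-1 x) = (ext k y <= x).
  by rewrite -(ext_mono k) extVK.
have klt x y : (y < ext k^-1 x) = (ext k y < x).
  by rewrite -(leW_mono (ext_mono k)) extVK.
have mE b : (b \in Interval (m i.1) (m i.2)) = (ext k b \in i).
  by case: i {oi ai iU} => -[[]x|[]] [[]y|[]] /=;
    rewrite !in_itv /= ?lek ?ltk ?kle ?klt.
exists (Interval (m i.1) (m i.2)); first split.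
- by case: i oi {ai iU mE} => -[[]x|[]] [[]y|[]].
- by rewrite mE.
- by move=> b /=; rewrite mE => /iU.
Qed.

Definition corresponds (X Y : set (dedekind L)) : Prop :=
  forall a, Y (ext g a) <-> X a.

Lemma nbhs_corresponds X Y a :
  corresponds X Y -> nbhs (ext g a) Y <-> nbhs a X.
Proof.
move=> XY; split=> [nY|nX].
  have : nbhs a (ext g @^-1` Y) by exact: ext_continuous nY.
  by apply: (@filterS _ (nbhs a)) => b /XY.
have : nbhs (ext g a) (ext g^-1 @^-1` X).
  by apply: ext_continuous; rewrite extK.
by apply: (@filterS _ (nbhs (ext g a))) => b /XY; rewrite extVK.
Qed.

Lemma interior_corresponds X Y : corresponds X Y -> corresponds X° Y°.
Proof. by move=> XY a; exact: nbhs_corresponds. Qed.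

Lemma closure_corresponds X Y :
  corresponds X Y -> corresponds (closure X) (closure Y).
Proof.
move=> XY a; split=> cl U nU; last first.
  have [b [Xb Ub]] := cl _ (ext_continuous nU).
  by exists (ext g b); split => //; exact/XY.
have nV : nbhs (ext g a) (ext g^-1 @^-1` U).
  by apply: ext_continuous; rewrite extK.
have [b [Yb Ub]] := cl _ nV; exists (ext g^-1 b); split => //.
by apply/XY; rewrite extVK.
Qed.

Lemma convex_hull_corresponds X Y :
  corresponds X Y -> corresponds (convex_hull X) (convex_hull Y).
Proof.
move=> XY a; split=> -[x [y [Xx Xy xay]]].
  exists (ext g^-1 x), (ext g^-1 y); split; [by apply/XY; rewrite extVK..|].
  by rewrite -(ext_mono g) -[X in _ && X](ext_mono g) !extVK.
by exists (ext g x), (ext g y); split; [exact/XY..|rewrite !ext_mono].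
Qed.

Lemma lbound_corresponds X Y :
  corresponds X Y -> corresponds (lbound X) (lbound Y).
Proof.
move=> XY a; split=> lb x Xx; first by rewrite -(ext_mono g); exact/lb/XY.
by rewrite -[x](extVK g) ext_mono; apply/lb/XY; rewrite extVK.
Qed.

Lemma ubound_corresponds X Y :
  corresponds X Y -> corresponds (ubound X) (ubound Y).
Proof.
move=> XY a; split=> ub x Xx; first by rewrite -(ext_mono g); exact/ub/XY.
by rewrite -[x](extVK g) ext_mono; apply/ub/XY; rewrite extVK.
Qed.

Lemma supp_conj (h : Aut L) : corresponds (supp h) (supp (g * h / g)).
Proof.
move=> a; rewrite /supp /= !extM extK; split=> ha e; apply: ha.
  by rewrite e.
exact: (can_inj (extK g)).
Qed.

Lemma Ep_conj (h : Aut L) : corresponds (Ep h) (Ep (g * h / g)).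
Proof.
have XY := convex_hull_corresponds (interior_corresponds
  (closure_corresponds (supp_conj h))).
have lX := lbound_corresponds XY; have uX := ubound_corresponds XY.
move=> a; split=> -[] [h1 h2].
- by left; split; [exact/lX|exact/(ubound_corresponds lX)].
- by right; split; [exact/uX|exact/(lbound_corresponds uX)].
- by left; split; [exact/lX|exact/(ubound_corresponds lX)].
- by right; split; [exact/uX|exact/(lbound_corresponds uX)].
Qed.

End Conjugation.

Variant EP_sym := Ed.

Definition EP_arity (r : EP_sym) : nat := 4.

Section EP.
Context d (L : chainType d) (G : groupClosed (Aut L)).

Definition Ep_group : set (dedekind L) :=
  \bigcup_(g in [set g : Aut L | g \in G]) Ep g.

Definition EP_point : Type := {a : dedekind L | a \in Ep_group}.

Definition EP : structure (relational EP_arity) :=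
  @Structure (relational EP_arity) EP_point
    (fun f => match f with end)
    (fun r (v : 'I_(EP_arity r) -> EP_point) =>
       (val v.#0 < val v.#1 /\ val v.#2 < val v.#3) \/
       (val v.#0 > val v.#1 /\ val v.#2 > val v.#3)).

Lemma Ep_group_invariant (g : elt G) (a : EP_point) :
  ext (val g) (val a) \in Ep_group.
Proof.
have /set_mem[h hG ha] := valP a; apply/mem_set.
exists (val g * h / val g); first by apply: gpredF (valP g); apply: gpredM => //; exact: valP.
exact/Ep_conj.
Qed.

Definition EP_action (g : elt G) (a : EP) : EP :=
  exist (fun b => is_true (b \in Ep_group)) _ (Ep_group_invariant g a).

Definition ACT_EP := ACT EP_action.

End EP.

Definition monotonic d1 d2 (T1 : orderType d1) (T2 : orderType d2)
    (f : T1 -> T2) : Prop :=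
  {mono f : x y / x <= y} \/ {mono f : x y /~ x <= y}.

Definition induces d1 d2 (L1 : chainType d1) (L2 : chainType d2)
    (G1 : groupClosed (Aut L1)) (G2 : groupClosed (Aut L2))
    (tau : dedekind L1 -> dedekind L2) (alpha : elt G1 -> elt G2) : Prop :=
  exists2 tau' : dedekind L2 -> dedekind L1,
    cancel tau tau' /\ cancel tau' tau &
    forall g : elt G1, ext (val (alpha g)) = tau \o ext (val g) \o tau'.

(* Main.v *)
Require Import Defs.
From mathcomp Require Import all_boot all_order.
From mathcomp Require Import interval boolp classical_sets set_interval topology.

Set Implicit Arguments.
Unset Strict Implicit.
Unset Printing Implicit Defensive.

Import Order.TTheory.
Local Open Scope order_scope.
Local Open Scope group_scope.
Local Notation eval := Defs.eval.

(* The order of the supports is first-order definable in the group. Disjointness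
   of supports is expressed by Rubin's commutator formula, which only needs
   nontrivial elements supported in every interval. The supports of [f] and [g]
   are then comparable (one lies entirely before the other) exactly when some
   nontrivial [u], [v] admit no conjugation making [f] meet [u] and [g] meet [v]:
   by 2-interval-transitivity such a conjugation exists as soon as two points of
   the supports of [f], [g] are ordered like two points of those of [u], [v],
   while incomparable supports realize both orders. Likewise two comparable pairs
   have the same direction exactly when such a conjugation exists. A point of
   [Ep] is coded by a comparable pair, as the endpoint of the second support on
   the side of the first one, which interprets [ACT_EP G] in [elt G] and gives
   (1). For (2), an isomorphism either preserves or reverses the order of the
   supports, and a point of the completion is the cut it makes in this order. *)

(** * Relations and terms definable in the first-order language of groups *)

Definition definable n (P : forall H : groupType, ('I_n -> H) -> Prop) : Prop :=
  exists p : formula group_sig n,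
    forall (H : groupType) (v : 'I_n -> group_structure H), holds p v <-> P H v.

Definition term_definable n (t : forall H : groupType, ('I_n -> H) -> H) :
    Prop :=
  exists u : term group_sig n,
    forall (H : groupType) (v : 'I_n -> group_structure H), eval v u = t H v.

Fixpoint lift_term (S : signature) n (t : term S n) : term S n.+1 :=
  match t with
  | Var i => Var S (lift ord0 i)
  | App f a => App (fun i => lift_term (a i))
  end.

Lemma eval_lift_term (S : signature) (M : structure S) n (t : term S n)
    (v : 'I_n.+1 -> M) :
  eval v (lift_term t) = eval (fun i => v (lift ord0 i)) t.
Proof. by elim: t => //= f a IH; congr fun_itp; apply/funext => i. Qed.

Lemma extend0 (T : Type) n (x : T) (v : 'I_n -> T) : extend x v ord0 = x.
Proof. by rewrite /extend unlift_none. Qed.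

Lemma extend_lift (T : Type) n (x : T) (v : 'I_n -> T) i :
  extend x v (lift ord0 i) = v i.
Proof. by rewrite /extend liftK. Qed.

Lemma extend_liftE (T : Type) n (x : T) (v : 'I_n -> T) :
  (fun i => extend x v (lift ord0 i)) = v.
Proof. by apply/funext => i; rewrite extend_lift. Qed.

Section TermDefinable.
Variable n : nat.
Implicit Types t u : forall H : groupType, ('I_n -> H) -> H.

Lemma term_definable_var (i : 'I_n) : term_definable (fun H v => v i).
Proof. by exists (Var _ i). Qed.

Lemma term_definable_one : term_definable (fun H (v : 'I_n -> H) => 1).
Proof. by exists (@App group_sig n GOne (fun=> @App group_sig n GOne
  (fun i => match i with Ordinal _ lt => False_rect _ (notF lt) end))). Qed.

Lemma term_definableM t u : term_definable t -> term_definable u ->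
  term_definable (fun H v => t H v * u H v).
Proof.
move=> [a ha] [b hb].
exists (@App group_sig n GMul (fun i => if (i : nat) is 0 then a else b)).
move=> H v.
by rewrite /= /arg /= ha hb.
Qed.

Lemma term_definableV t : term_definable t ->
  term_definable (fun H v => (t H v)^-1).
Proof.
move=> [a ha]; exists (@App group_sig n GInv (fun=> a)) => H v.
by rewrite /= /arg /= ha.
Qed.

Lemma term_definable_lift t : term_definable t ->
  term_definable (fun H (w : 'I_n.+1 -> H) => t H (fun i => w (lift ord0 i))).
Proof.
by move=> [a ha]; exists (lift_term a) => H v; rewrite eval_lift_term ha.
Qed.

End TermDefinable.

Section Definable.
Variable n : nat.
Implicit Types t u : forall H : groupType, ('I_n -> H) -> H.
Implicit Types P Q : forall H : groupType, ('I_n -> H) -> Prop.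

Lemma definable_eq t u : term_definable t -> term_definable u ->
  definable (fun H v => t H v = u H v).
Proof. by move=> [a ha] [b hb]; exists (FEq a b) => H v /=; rewrite ha hb. Qed.

Lemma definable_False : definable (fun H (v : 'I_n -> H) => False).
Proof. by exists (FFalse _ _). Qed.

Lemma definable_and P Q : definable P -> definable Q ->
  definable (fun H v => P H v /\ Q H v).
Proof. by move=> [a ha] [b hb]; exists (FAnd a b) => H v /=; rewrite ha hb. Qed.

Lemma definable_or P Q : definable P -> definable Q ->
  definable (fun H v => P H v \/ Q H v).
Proof. by move=> [a ha] [b hb]; exists (FOr a b) => H v /=; rewrite ha hb. Qed.

Lemma definable_imp P Q : definable P -> definable Q ->
  definable (fun H v => P H v -> Q H v).
Proof.
by move=> [a ha] [b hb]; exists (FImp a b) => H v /=; rewrite ha hb.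
Qed.

Lemma definable_not P : definable P -> definable (fun H v => ~ P H v).
Proof. by move=> hP; apply: definable_imp => //; exact: definable_False. Qed.

Lemma definable_neq t u : term_definable t -> term_definable u ->
  definable (fun H v => t H v <> u H v).
Proof. by move=> ht hu; apply: definable_not; exact: definable_eq. Qed.

Lemma definable_forall (P : forall H : groupType, ('I_n -> H) -> H -> Prop) :
  definable (fun H (w : 'I_n.+1 -> H) =>
    P H (fun i => w (lift ord0 i)) (w ord0)) ->
  definable (fun H v => forall x, P H v x).
Proof.
move=> [a ha]; exists (FAll a) => H v /=.
by split=> h x; have := h x; rewrite ha extend0 extend_liftE.
Qed.

Lemma definable_exists (P : forall H : groupType, ('I_n -> H) -> H -> Prop) :
  definable (fun H (w : 'I_n.+1 -> H) =>
    P H (fun i => w (lift ord0 i)) (w ord0)) ->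
  definable (fun H v => exists x, P H v x).
Proof.
move=> [a ha]; exists (FEx a) => H v /=.
by split=> -[x h]; exists x; move: h; rewrite ha extend0 extend_liftE.
Qed.

End Definable.

(** * Invariance of definable relations under isomorphisms *)

Lemma multiplicative1 (H1 H2 : groupType) (alpha : {multiplicative H1 -> H2}) :
  alpha 1 = 1.
Proof. by apply: (mulgI (alpha 1)); rewrite -gmulfM !mulg1. Qed.

Lemma multiplicativeV (H1 H2 : groupType) (alpha : {multiplicative H1 -> H2}) :
  {morph alpha : x / x^-1}.
Proof.
by move=> x; apply: (mulgI (alpha x)); rewrite -gmulfM !mulgV multiplicative1.
Qed.

Lemma eval_morphism (H1 H2 : groupType) (alpha : {multiplicative H1 -> H2}) n
    (t : term group_sig n) (v : 'I_n -> group_structure H1) :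
  alpha (eval v t) = eval (alpha \o v : 'I_n -> group_structure H2) t.
Proof.
elim: t => //= -[] a IH; rewrite /arg /=.
- by rewrite gmulfM !IH.
- by rewrite multiplicativeV IH.
- exact: multiplicative1.
Qed.

Lemma holds_isomorphism (H1 H2 : groupType)
    (alpha : {multiplicative H1 -> H2}) n (p : formula group_sig n)
    (v : 'I_n -> group_structure H1) :
  bijective alpha ->
  holds p v <-> holds p (alpha \o v : 'I_n -> group_structure H2).
Proof.
move=> [beta alphaK betaK].
have ext_comp m x (w : 'I_m -> H1) :
    extend (alpha x) (alpha \o w) = alpha \o extend x w.
  by apply/funext => i; rewrite /extend /=; case: unlift.
elim: p v => {n}.
- move=> n a b v /=; rewrite -!eval_morphism.
  by split=> [->//|]; exact: (can_inj alphaK).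
- by move=> n [].
- by [].
- by move=> n p IHp q IHq v /=; rewrite IHp IHq.
- by move=> n p IHp q IHq v /=; rewrite IHp IHq.
- by move=> n p IHp q IHq v /=; rewrite IHp IHq.
- move=> n p IHp v /=; split=> hp x.
    by rewrite -(betaK x) ext_comp -IHp; exact: hp.
  by rewrite IHp -ext_comp; exact: hp.
- move=> n p IHp v /=; split=> -[x hp].
    by exists (alpha x); rewrite ext_comp -IHp.
  by exists (beta x); rewrite IHp -ext_comp betaK.
Qed.

Lemma definable_isomorphism n (P : forall H : groupType, ('I_n -> H) -> Prop)
    (H1 H2 : groupType) (alpha : {multiplicative H1 -> H2}) (v : 'I_n -> H1) :
  definable P -> bijective alpha -> P H1 v <-> P H2 (alpha \o v).
Proof.
by move=> [p hp] bij; rewrite -!hp; exact: holds_isomorphism.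
Qed.

(** * First-order formulas for the order of supports *)

Section Interpretation.
Variable H : groupType.
Implicit Types f g h u v e r s : H.

(** [c] is the commutator [[f2, h]]; the last two clauses say that [[f1, c]] is a nontrivial element
    of the centralizer of [g]. *)
Definition disjoint_elts f g : Prop :=
  forall h, f * h <> h * f ->
    exists f1 f2, (f1 * g = g * f1 /\ f2 * g = g * f2) /\
      let c := f2 * h * f2^-1 * h^-1 in
      f1 * c <> c * f1 /\
      (f1 * c * f1^-1 * c^-1) * g = g * (f1 * c * f1^-1 * c^-1).

Definition simultaneously_meet f g u v : Prop :=
  exists k, ~ disjoint_elts (k * f * k^-1) u /\
            ~ disjoint_elts (k * g * k^-1) v.

Definition separated_elts f g : Prop :=
  (f <> 1 /\ g <> 1) /\
  exists u v, (u <> 1 /\ v <> 1) /\ ~ simultaneously_meet f g u v.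

Definition same_direction f g f' g' : Prop :=
  (separated_elts f g /\ separated_elts f' g') /\ simultaneously_meet f g f' g'.

Definition beyond e f g : Prop :=
  forall e', same_direction e' g f g -> same_direction e' e f g.

(* The pair [f], [g] codes the endpoint [x] of the support of [g] on the side of
   [f], and the pair [r], [s] fixes an orientation: [after e f g r s] says that
   the support of [e] lies after [x], and [beyond e f g] that [x] lies between
   those of [f] and [e]. *)
Definition after e f g r s : Prop :=
  (same_direction f g r s /\ beyond e f g) \/
  (same_direction g f r s /\ same_direction e g f g).

Definition precedes f1 g1 f2 g2 r s : Prop :=
  exists e, after e f1 g1 r s /\ after e f2 g2 s r.

(** The pair [r], [s] ranges over both orientations, so equality of the coded points is expressed as
    the failure of both strict inequalities. *)
Definition codes_equal f1 g1 f2 g2 : Prop :=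
  ~ exists r s, separated_elts r s /\ precedes f1 g1 f2 g2 r s.

Definition codes_equidirected f1 g1 f2 g2 f3 g3 f4 g4 : Prop :=
  exists r s, separated_elts r s /\
    (precedes f1 g1 f2 g2 r s /\ precedes f3 g3 f4 g4 r s).

End Interpretation.

(** * Definability of the formulas on supports *)

Local Notation term_function n := (forall H : groupType, ('I_n -> H) -> H).

(** A parameter may occur below several quantifiers, so its definability hypothesis is tried under
    zero to four lifts. *)
Ltac definable_atom :=
  match goal with
  | h : term_definable _ |- _ =>
    let h1 := constr:(term_definable_lift h) in
    let h2 := constr:(term_definable_lift h1) in
    let h3 := constr:(term_definable_lift h2) in
    first [exact h | exact h1 | exact h2 | exact h3
          | exact (term_definable_lift h3)]
  | |- _ => exact: term_definable_var
  end.

Ltac definability :=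
  repeat first [ definable_atom
    | apply: definable_forall | apply: definable_exists
    | apply: definable_and | apply: definable_or
    | apply: definable_neq | apply: definable_eq
    | apply: definable_not | apply: definable_imp
    | exact: term_definable_one
    | apply: term_definableM | apply: term_definableV ].

Lemma definable_disjoint_elts n (f g : term_function n) :
  term_definable f -> term_definable g ->
  definable (fun H w => disjoint_elts (f H w) (g H w)).
Proof. by move=> df dg; rewrite /disjoint_elts; definability. Qed.

Lemma definable_simultaneously_meet n (f g u v : term_function n) :
  term_definable f -> term_definable g -> term_definable u ->
  term_definable v ->
  definable (fun H w => simultaneously_meet (f H w) (g H w) (u H w) (v H w)).
Proof.
move=> df dg du dv; apply: definable_exists.
by apply: definable_and; apply: definable_not;
  apply: definable_disjoint_elts; definability.
Qed.

Lemma definable_separated_elts n (f g : term_function n) :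
  term_definable f -> term_definable g ->
  definable (fun H w => separated_elts (f H w) (g H w)).
Proof.
move=> df dg; apply: definable_and; first by definability.
do 2 apply: definable_exists.
apply: definable_and; first by definability.
by apply: definable_not; apply: definable_simultaneously_meet; definability.
Qed.

Lemma definable_same_direction n (f g u v : term_function n) :
  term_definable f -> term_definable g -> term_definable u ->
  term_definable v ->
  definable (fun H w => same_direction (f H w) (g H w) (u H w) (v H w)).
Proof.
move=> df dg du dv; apply: definable_and.
  by apply: definable_and; exact: definable_separated_elts.
exact: definable_simultaneously_meet.
Qed.

Lemma definable_after n (e f g r s : term_function n) :
  term_definable e -> term_definable f -> term_definable g ->
  term_definable r -> term_definable s ->
  definable (fun H w => after (e H w) (f H w) (g H w) (r H w) (s H w)).
Proof.
move=> de df dg dr ds; apply: definable_or; apply: definable_and;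
  try exact: definable_same_direction.
apply: definable_forall.
by apply: definable_imp; apply: definable_same_direction; definability.
Qed.

Lemma definable_precedes n (f1 g1 f2 g2 r s : term_function n) :
  term_definable f1 -> term_definable g1 ->
  term_definable f2 -> term_definable g2 ->
  term_definable r -> term_definable s ->
  definable (fun H w => precedes (f1 H w) (g1 H w) (f2 H w) (g2 H w)
    (r H w) (s H w)).
Proof.
move=> df1 dg1 df2 dg2 dr ds; apply: definable_exists.
by apply: definable_and; apply: definable_after; definability.
Qed.

Lemma definable_codes_equal n (f1 g1 f2 g2 : term_function n) :
  term_definable f1 -> term_definable g1 ->
  term_definable f2 -> term_definable g2 ->
  definable (fun H w => codes_equal (f1 H w) (g1 H w) (f2 H w) (g2 H w)).
Proof.
move=> df1 dg1 df2 dg2; apply: definable_not; do 2 apply: definable_exists.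
apply: definable_and; first by apply: definable_separated_elts; definability.
by apply: definable_precedes; definability.
Qed.

Lemma definable_codes_equidirected n
    (f1 g1 f2 g2 f3 g3 f4 g4 : term_function n) :
  term_definable f1 -> term_definable g1 ->
  term_definable f2 -> term_definable g2 ->
  term_definable f3 -> term_definable g3 ->
  term_definable f4 -> term_definable g4 ->
  definable (fun H w => codes_equidirected (f1 H w) (g1 H w) (f2 H w) (g2 H w)
    (f3 H w) (g3 H w) (f4 H w) (g4 H w)).
Proof.
move=> df1 dg1 df2 dg2 df3 dg3 df4 dg4; do 2 apply: definable_exists.
apply: definable_and; first by apply: definable_separated_elts; definability.
by apply: definable_and; apply: definable_precedes; definability.
Qed.


Lemma separated_elts_isomorphism (H1 H2 : groupType)
    (alpha : {multiplicative H1 -> H2}) f g :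
  bijective alpha -> separated_elts f g <-> separated_elts (alpha f) (alpha g).
Proof.
move=> bij.
pose v (i : 'I_2) := if (i : nat) is 0 then f else g.
have dS : definable (fun H (w : 'I_2 -> H) =>
    separated_elts (w ord0) (w ord_max)).
  by apply: definable_separated_elts; exact: term_definable_var.
exact: (definable_isomorphism v dS bij).
Qed.

Lemma same_direction_isomorphism (H1 H2 : groupType)
    (alpha : {multiplicative H1 -> H2}) f g f' g' :
  bijective alpha ->
  same_direction f g f' g' <->
  same_direction (alpha f) (alpha g) (alpha f') (alpha g').
Proof.
move=> bij; pose v (i : 'I_4) := nth f [:: f; g; f'; g'] i.
have dS : definable (fun H (w : 'I_4 -> H) => same_direction
    (w (inord 0)) (w (inord 1)) (w (inord 2)) (w (inord 3))).
  by apply: definable_same_direction; exact: term_definable_var.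
by have := definable_isomorphism v dS bij; rewrite /v /= !inordK.
Qed.

(** * Semantics of the formulas *)

Section Orientation.
Context d (T : orderType d).
Implicit Types (b : bool) (x y z : T) (X : set T).

(* Statements are made for the order and for its reverse at once, according to
   the boolean [b]; so [is_inf false] is a supremum. *)
Definition le_dir b x y := if b then x <= y else y <= x.
Definition lt_dir b x y := if b then x < y else y < x.

Lemma lt_dirW b x y : lt_dir b x y -> le_dir b x y.
Proof. by case: b => /ltW. Qed.

Lemma le_dir_trans b y x z : le_dir b x y -> le_dir b y z -> le_dir b x z.
Proof. by case: b => /= xy yz; [exact: le_trans yz|exact: le_trans xy]. Qed.

Lemma lt_le_dir b y x z : lt_dir b x y -> le_dir b y z -> lt_dir b x z.
Proof.
by case: b => /= xy yz; [exact: lt_le_trans yz|exact: le_lt_trans xy].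
Qed.

Lemma le_lt_dir b y x z : le_dir b x y -> lt_dir b y z -> lt_dir b x z.
Proof.
by case: b => /= xy yz; [exact: le_lt_trans yz|exact: lt_le_trans xy].
Qed.

Lemma lt_dir_trans b y x z : lt_dir b x y -> lt_dir b y z -> lt_dir b x z.
Proof. by move=> xy /lt_dirW; exact: lt_le_dir. Qed.

Lemma lt_dir_irr b x : lt_dir b x x -> False.
Proof. by case: b; rewrite /= ltxx. Qed.

Lemma lt_dirN b x y : lt_dir (~~ b) x y = lt_dir b y x.
Proof. by case: b. Qed.

Lemma le_dirN b x y : le_dir (~~ b) x y = le_dir b y x.
Proof. by case: b. Qed.

Lemma not_le_dir b x y : ~ le_dir b x y -> lt_dir b y x.
Proof. by case: b => /negP; rewrite -ltNge. Qed.

Lemma le_dir_anti b x y : le_dir b x y -> le_dir b y x -> x = y.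
Proof. by case: b => /= xy yx; apply/le_anti/andP. Qed.

Lemma le_dir_total b x y : le_dir b x y \/ le_dir b y x.
Proof. by case: b => /=; case: (leP x y) => [|/ltW]; auto. Qed.

Definition is_lower b X x := forall y, X y -> le_dir b x y.

Definition is_inf b X x :=
  is_lower b X x /\ forall y, is_lower b X y -> le_dir b y x.

End Orientation.

(** * Displaced intervals and Rubin's formula for disjoint supports *)

Section Moves.
Context d (L : chainType d) (G : groupClosed (Aut L)).
Local Notation T := (dedekind L).
Implicit Types (f g h k : elt G) (x y p q : T).

Definition act g : T -> T := ext (val g).

Lemma actM g h x : act (g * h) x = act g (act h x).
Proof. exact: extM. Qed.

Lemma act1 x : act 1 x = x.
Proof. exact: ext1. Qed.

Lemma actK g : cancel (act g) (act g^-1).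
Proof. exact: extK. Qed.

Lemma actVK g : cancel (act g^-1) (act g).
Proof. exact: extVK. Qed.

Lemma act_le g : {mono act g : x y / x <= y}.
Proof. exact: ext_mono. Qed.

Lemma act_lt g : {mono act g : x y / x < y}.
Proof. exact: leW_mono (act_le g). Qed.

Lemma act_inj g : injective (act g).
Proof. exact: can_inj (actK g). Qed.

Lemma act_faithful f g : act f =1 act g -> f = g.
Proof.
move=> fg; apply/val_inj/eq_aut => x; apply: (inc_inj (@embed_mono _ L)).
by rewrite -!ext_embed; exact: fg.
Qed.

Definition moves g : set T := [set x | act g x <> x].

Lemma fixed_or_moves g x : act g x = x \/ moves g x.
Proof. exact: EM. Qed.

Lemma moves_neq1 g x : moves g x -> g <> 1.
Proof. by move=> gx g1; apply: gx; rewrite g1 act1. Qed.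

Lemma neq1_moves g : g <> 1 -> exists x, moves g x.
Proof.
move=> g1; apply: contrapT => nex; apply: g1; apply: act_faithful => x.
by rewrite act1; apply: contrapT => gx; apply: nex; exists x.
Qed.

Lemma movesV g x : moves g^-1 x -> moves g x.
Proof. by move=> gx e; apply: gx; rewrite -[in LHS]e actK. Qed.

Lemma moves_act g x : moves g x -> moves g (act g x).
Proof. by move=> gx /act_inj. Qed.

Lemma moves_conj k g x : moves (k * g * k^-1) x <-> moves g (act k^-1 x).
Proof.
rewrite /moves /= !actM; split=> h e; apply: h; first by rewrite e actVK.
by rewrite -[in RHS]e actK.
Qed.

Lemma dedekind_dense x y : x < y -> exists z, x < z < y.
Proof. by move=> /embed_dense[z]; exists (embed z). Qed.

Lemma exists_lt_dir (c : bool) x : exists y, lt_dir c x y.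
Proof.
have [a [b /andP[ax xb]]] := dedekind_noends x.
by case: c; [exists (embed b)|exists (embed a)].
Qed.

(** [g] throws the interval from [p] to [q] off itself. The form with half-lines, stronger than
    disjointness from the image, also controls all further iterates of [g]. *)
Definition displaces g p q :=
  (forall y, p < y -> q <= act g y) \/ (forall y, y < q -> act g y <= p).

(** For [x < act g x], a point [q] strictly between them serves as upper end and its preimage under
    [g] as lower end; the other case is symmetric. The ends are then cut down to [l] and [r]. *)
Lemma displaces_near g x l r : moves g x -> l < x < r ->
  exists p q, [/\ p < x < q, l <= p, q <= r & displaces g p q].
Proof.
move=> gx /andP[lx xr].
have [xg|gx'] : x < act g x \/ act g x < x.
  by case: (ltgtP x (act g x)) => [||e]; [left|right|case: gx].
- have [q /andP[xq qg]] := dedekind_dense xg.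
  have px : act g^-1 q < x by rewrite -(act_lt g) actVK.
  exists (Order.max l (act g^-1 q)), (Order.min r q); split.
  + by rewrite gt_max lx px lt_min xr xq.
  + by rewrite le_max lexx.
  + by rewrite ge_min lexx.
  + left=> y; rewrite gt_max => /andP[_ qy]; rewrite ge_min; apply/orP; right.
    by apply: ltW; rewrite -(act_lt g^-1) actK.
- have [p /andP[gp px]] := dedekind_dense gx'.
  have xq : x < act g^-1 p by rewrite -(act_lt g) actVK.
  exists (Order.max l p), (Order.min r (act g^-1 p)); split.
  + by rewrite gt_max lx px lt_min xr xq.
  + by rewrite le_max lexx.
  + by rewrite ge_min lexx.
  + right=> y; rewrite lt_min => /andP[_ qy]; rewrite le_max; apply/orP; right.
    by apply: ltW; rewrite -(act_lt g^-1) actK.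
Qed.

Lemma displaces_iter g p q y n :
  displaces g p q -> p < y < q -> ~ p < iter n.+1 (act g) y < q.
Proof.
move=> dg /andP[py yq]; case: dg => dg /andP[].
  move=> _; apply/negP; rewrite -leNgt; elim: n => [|n IH]; first exact: dg.
  by apply: dg; apply: lt_le_trans IH; exact: lt_trans yq.
move=> + _; apply/negP; rewrite -leNgt; elim: n => [|n IH]; first exact: dg.
by apply: dg; apply: le_lt_trans IH _; exact: lt_trans yq.
Qed.

Lemma displaces_out g p q y : displaces g p q -> p < y < q -> ~ p < act g y < q.
Proof. by move=> dg; exact: (@displaces_iter g p q y 0 dg). Qed.

Lemma displaces_moves g p q y : displaces g p q -> p < y < q -> moves g y.
Proof. by move=> dg pyq e; apply: (displaces_out dg (y := y)); rewrite ?e. Qed.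

Lemma displaces_sub g p q p' q' : displaces g p q -> p <= p' -> q' <= q ->
  displaces g p' q'.
Proof.
move=> dg pp qq; case: dg => dg; [left|right] => y yp.
  by apply: le_trans qq _; apply: dg; exact: le_lt_trans yp.
by apply: le_trans pp; apply: dg; exact: lt_le_trans qq.
Qed.

(** Supports are open and so have no extreme element. This is what later turns non-strict bounds on
    supports into strict ones. *)
Lemma moves_near_dir b g x : moves g x -> exists2 y, moves g y & lt_dir b x y.
Proof.
move=> gx; have [l [r lxr]] := dedekind_noends x.
have [p [q [/andP[px xq] _ _ dg]]] := displaces_near gx lxr.
case: b => /=.
  have [y /andP[xy yq]] := dedekind_dense xq; exists y => //.
  by apply: (displaces_moves dg); rewrite yq (lt_trans px).
have [y /andP[py yx]] := dedekind_dense px; exists y => //.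
by apply: (displaces_moves dg); rewrite py (lt_trans yx).
Qed.

Definition supported g p q := forall x, moves g x -> p < x < q.

Lemma supported_fixed g p q x : supported g p q -> ~ p < x < q -> act g x = x.
Proof. by move=> gpq; apply: contra_notP => /gpq. Qed.

Lemma supported_act g p q x : supported g p q -> p < x < q -> p < act g x < q.
Proof.
move=> gpq pxq; have [->//|gx] := fixed_or_moves g x.
exact/gpq/moves_act.
Qed.

Lemma supportedV g p q : supported g p q -> supported g^-1 p q.
Proof. by move=> gpq x /movesV/gpq. Qed.

Lemma disjoint_moves_commute f g :
  (forall x, moves f x -> act g x = x) -> f * g = g * f.
Proof.
move=> fg; apply: act_faithful => x; rewrite !actM.
have [fx|fx] := fixed_or_moves f x; last first.
  by rewrite fg // fg //; exact: moves_act.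
have [gx|gx] := fixed_or_moves g x; first by rewrite gx fx gx.
rewrite fx; apply: contrapT => fgx; apply: gx.
by apply: (@act_inj g); exact: fg.
Qed.

Lemma commute_moves f g x : f * g = g * f -> moves g x -> moves g (act f x).
Proof. by move=> fg gx; rewrite /moves /= -actM -fg actM => /act_inj. Qed.

(** This is the form in which the bounded element enters the rest of the argument;
    [transitive_locally_moving] derives it. *)
Definition locally_moving :=
  forall p q, p < q -> exists2 g, g <> 1 & supported g p q.

Hypothesis lm : locally_moving.

(** Some point is moved by both [f] and [h], hence some interval is displaced by both, and [g] is
    trivial there. Take [f2] supported in it and [f1] supported in a smaller interval displaced by
    [f2]. Then [c] acts like [f2] on the large interval, so [f1] does not commute with [c], while
    [[f1, c]] is supported in the large interval and commutes with [g]. *)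
Lemma disjoint_disjoint_elts f g :
  (forall x, moves f x -> act g x = x) -> disjoint_elts f g.
Proof.
move=> fg h fh.
have [x fx hx] : exists2 x, moves f x & moves h x.
  apply: contrapT => nex; apply: fh; apply: disjoint_moves_commute => x fx.
  by apply: contrapT => hx; apply: nex; exists x.
have [l [r lxr]] := dedekind_noends x.
have [p0 [q0 [/andP[px0 xq0] _ _ df]]] := displaces_near fx lxr.
have [p [q [/andP[px xq] p0p qq0 dh]]] :=
  displaces_near hx (introT andP (conj px0 xq0)).
have {}df := displaces_sub df p0p qq0.
have [f2 f21 f2I] := lm (lt_trans px xq).
have [y f2y] := neq1_moves f21.
have [p' [q' [/andP[p'y yq'] pp' q'q df2]]] := displaces_near f2y (f2I _ f2y).
have [f1 f11 f1J] := lm (lt_trans p'y yq').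
have JI z : p' < z < q' -> p < z < q.
  by move=> /andP[? ?]; rewrite (le_lt_trans pp') ?(lt_le_trans _ q'q).
have f1I : supported f1 p q by move=> z /f1J/JI.
have gI k : supported k p q -> k * g = g * k.
  move=> kI; apply: disjoint_moves_commute => z /kI zI.
  by apply: fg; exact: displaces_moves zI.
exists f1, f2; split; first by split; apply: gI.
set c := f2 * h * f2^-1 * h^-1 => /=.
(* As [h] displaces the interval, [act h^-1 z] lies outside it and is fixed by [f2^-1]. *)
have cI z : p < z < q -> act c z = act f2 z.
  move=> zI; rewrite !actM; congr act.
  rewrite (supported_fixed (supportedV f2I)) ?actVK // => hz.
  by apply: (displaces_out dh hz); rewrite actVK.
have cVI z : ~ p < z < q -> ~ p < act c^-1 z < q.
  by move=> zI cz; apply: zI; rewrite -[z](actVK c) cI // supported_act.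
split.
  have [z f1z] := neq1_moves f11 => e; apply: (f1z).
  have zJ := f1J _ f1z; have := congr1 (fun k => act k z) e.
  rewrite (actM f1 c) (actM c f1) !cI; [|exact/JI/supported_act|exact: JI].
  by rewrite (supported_fixed f1J) => [/act_inj <-//|]; exact: displaces_out zJ.
apply: gI => z; apply: contra_notP => zI.
rewrite (actM _ c^-1) (actM _ f1^-1) (actM f1 c).
rewrite (supported_fixed (supportedV f1I) (cVI _ zI)) actVK.
exact: supported_fixed zI.
Qed.

(** If both [f] and [g] moved [x], take [h] supported in an interval displaced by both. It does not
    commute with [f], and the formula yields a nontrivial [k] commuting with [g] whose support is
    too small to contain a [g]-orbit. *)
Lemma disjoint_elts_disjoint f g :
  disjoint_elts f g -> forall x, moves f x -> act g x = x.
Proof.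
move=> fg x fx; apply: contrapT => gx.
have [l [r lxr]] := dedekind_noends x.
have [p0 [q0 [/andP[px0 xq0] _ _ df]]] := displaces_near fx lxr.
have [p [q [/andP[px xq] p0p qq0 dg]]] :=
  displaces_near gx (introT andP (conj px0 xq0)).
have {}df := displaces_sub df p0p qq0.
have [h h1 hI] := lm (lt_trans px xq).
have [y hy] := neq1_moves h1.
have [|f1 [f2 [[f1g f2g] [kn kg]]]] := fg h.
  move=> /(congr1 (fun k => act k y)); rewrite !actM => e.
  have := hI _ hy => yI; apply: hy; apply: (@act_inj f); rewrite e.
  exact/(supported_fixed hI)/displaces_out.
move: kn kg => /=; set c := f2 * h * f2^-1 * h^-1.
set k := f1 * c * f1^-1 * c^-1.
move=> kn kg.
have gV u : u * g = g * u -> u^-1 * g = g * u^-1.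
  by move=> ug; apply/esym/commuteV/esym.
(* The translates of the interval by these four elements cover the support of [k]: [c] moves points
   only in the interval and its [f2]-image, and [k] only there and in the [f1]-images of both. *)
pose us : 4.-tuple (elt G) := [tuple 1; f2; f1; f1 * f2].
have usg (i : 'I_4) : tnth us i * g = g * tnth us i.
  have : tnth us i \in us by exact: mem_tnth.
  rewrite !inE => /or4P[] /eqP -> //; first by rewrite mul1g mulg1.
  by rewrite -mulgA f2g mulgA f1g mulgA.
have csupp z : moves c z -> p < z < q \/ p < act f2^-1 z < q.
  apply: contra_notP => /not_orP[zI fzI].
  rewrite !actM (supported_fixed (supportedV hI)) //.
  by rewrite (supported_fixed hI) // actVK.
have ksupp z : moves k z -> exists i : 'I_4, p < act (tnth us i)^-1 z < q.
  move=> kz; have : moves c z \/ moves c (act f1^-1 z).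
    apply: contra_notP kz => /not_orP[/contrapT cz /contrapT cfz].
    have cVz : act c^-1 z = z by rewrite -[in LHS]cz actK.
    by rewrite (actM _ c^-1) (actM _ f1^-1) (actM f1 c) cVz cfz actVK.
  case=> /csupp [] zI.
  - by exists (inord 0); rewrite (tnth_nth 1) /= inordK //= invg1 act1.
  - by exists (inord 1); rewrite (tnth_nth 1) /= inordK.
  - by exists (inord 2); rewrite (tnth_nth 1) /= inordK.
  - by exists (inord 3); rewrite (tnth_nth 1) /= inordK //= invgM actM.
have [z kz] : exists z, moves k z.
  apply: neq1_moves => k1; apply: kn.
  by have := congr1 (fun e => e * c * f1) k1; rewrite mul1g /k !mulgVK.
have orb n : moves k (iter n (act g) z).
  by elim: n => //= n; exact: commute_moves.
(* The support of [k] lies in four sets, each of which contains at most one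
   point of a [g]-orbit, but it is invariant under [g]. *)
have /choice[i iI] : forall n : 'I_5, exists i : 'I_4,
    p < act (tnth us i)^-1 (iter n (act g) z) < q.
  by move=> n; exact: ksupp.
have : injective i.
  have iterV j n w : act (tnth us j)^-1 (iter n (act g) w) =
      iter n (act g) (act (tnth us j)^-1 w).
    elim: n => //= n IH; rewrite -actM gV ?usg // actM IH //.
  have ltF (m n : 'I_5) : (m < n)%N -> i m <> i n.
    move=> mn imn; have := iI n.
    rewrite -imn iterV -(subnK mn) addnS -addSn iterD.
    by apply: displaces_iter => //; rewrite -iterV.
  move=> m n imn; apply/val_inj; case: (ltngtP m n) => // mn.
    by case: (ltF _ _ mn).
  by case: (ltF _ _ mn).
by move=> /leq_card; rewrite !card_ord.
Qed.

Lemma disjoint_eltsP f g :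
  disjoint_elts f g <-> forall x, moves f x -> act g x = x.
Proof.
by split; [exact: disjoint_elts_disjoint|exact: disjoint_disjoint_elts].
Qed.

Lemma not_disjoint_elts f g :
  ~ disjoint_elts f g <-> exists2 x, moves f x & moves g x.
Proof.
rewrite disjoint_eltsP; split=> [nfg|[x fx gx] fg]; last exact/gx/fg.
apply: contrapT => nex; apply: nfg => x fx; apply: contrapT => gx.
by apply: nex; exists x.
Qed.

End Moves.

(** * Comparison of supports and of coded points under 2-interval-transitivity *)

Section Transitive.
Context d (L : chainType d) (G : groupClosed (Aut L)).
Local Notation T := (dedekind L).
Implicit Types (e f g h k r s u v : elt G) (x y : T) (c : bool).

Lemma L_interval_itv (x y : L) : x < y -> L_interval `]x, y[%classic.
Proof. by move=> xy; apply: Or41; exists x, y. Qed.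

Lemma itv_neq0 (x y : L) : x < y -> (`]x, y[ !=set0)%classic.
Proof. by move=> /chain_dense[z xzy]; exists z; rewrite /= in_itv. Qed.

Lemma embed_lt (x y : L) : (embed x < embed y) = (x < y).
Proof. by rewrite (leW_mono (@embed_mono _ L)). Qed.

Lemma embed_act g (x : L) : embed ((val g : Aut L) x) = act g (embed x).
Proof. by rewrite /act ext_embed. Qed.

Hypothesis trans : two_interval_transitive G.

(** Transitivity is applied to the two rays outside a bounded interval []P, Q[] containing the
    support of [g0]: some [k] brings a point of each ray between [p] and [q], and with them the
    support of the conjugate of [g0] by [k]. *)
Lemma transitive_locally_moving : has_bounded_element G -> locally_moving G.
Proof.
move=> [g0 [Gg0 g01 [A [B [AB g0AB]]]]] p q pq.
pose g : elt G := exist _ g0 Gg0.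
have gAB : supported g A B by move=> x /g0AB; rewrite /= in_itv.
have [P [_ /andP[PA _]]] := dedekind_noends A.
have [_ [Q /andP[_ BQ]]] := dedekind_noends B.
have PQ : P < Q.
  by rewrite -embed_lt (lt_trans PA) // (lt_trans AB).
have [y1 /andP[py1 y1q]] := embed_dense pq.
have [y2 /andP[y12 y2q]] := embed_dense y1q.
have [y3 /andP[y23 y3q]] := embed_dense y2q.
rewrite !embed_lt in y12 y23.
have [||||k0 [Gk0 [_ [[z1 z1P <-]]]]] := trans (I1 := `]-oo, P[%classic)
    (I2 := `]Q, +oo[%classic) _ _ (L_interval_itv y12)
    (L_interval_itv y23).
- by apply: Or42; exists P.
- by apply: Or43; exists Q.
- split.
  + by have [z zP] := chain_nomin P; exists z; rewrite /= in_itv.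
  + by have [z zQ] := chain_nomax Q; exists z; rewrite /= in_itv /= zQ.
  + move=> a b; rewrite /= !in_itv /= andbT => aP Qb.
    by rewrite (lt_trans aP) // (lt_trans PQ).
- split; [exact: itv_neq0..|move=> a b; rewrite /= !in_itv /=].
  by move=> /andP[_ ay] /andP[yb _]; exact: lt_trans yb.
rewrite /= !in_itv /= in z1P * => /andP[yk1 _] [_ [[z2 + <-]]].
rewrite /= !in_itv /= andbT => Qz2 /andP[_ k2y].
pose k : elt G := exist _ k0 Gk0.
exists (k * g * k^-1).
  move=> kg; move/eqP: g01; apply; change (val g = val (1 : elt G)); congr val.
  by apply: (mulgI k); apply: (mulIg k^-1); rewrite kg mulg1 mulgV.
move=> x /moves_conj/gAB/andP[Ax xB].
rewrite -(act_lt k) actVK in Ax; rewrite -(act_lt k) actVK in xB.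
apply/andP; split.
  apply: lt_trans py1 _; apply: lt_trans Ax.
  apply: lt_trans (_ : act k (embed z1) < _).
    by rewrite -embed_act embed_lt.
  by rewrite act_lt (lt_trans _ PA) // embed_lt.
apply: lt_trans y3q; apply: lt_trans xB _.
apply: lt_trans (_ : act k (embed z2) < _).
  by rewrite act_lt (lt_trans BQ) // embed_lt.
by rewrite -embed_act embed_lt.
Qed.

Hypothesis lm : locally_moving G.

Lemma moves_L_interval g x (l r : T) : moves g x -> l < x < r ->
  exists p q : L, [/\ p < q, l < embed p, embed q < r &
    forall z : L, p < z < q -> moves g (embed z)].
Proof.
move=> gx lxr.
have [p0 [q0 [/andP[px xq] lp qr dg]]] := displaces_near gx lxr.
have [p /andP[pp px']] := embed_dense px.
have [q /andP[xq' qq]] := embed_dense xq.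
exists p, q; split.
- by rewrite -embed_lt (lt_trans px').
- exact: le_lt_trans pp.
- exact: lt_le_trans qr.
- move=> z /andP[pz zq]; apply: (displaces_moves dg).
  by rewrite (lt_trans pp) ?embed_lt //= (lt_trans _ qq) ?embed_lt.
Qed.

Lemma moves_L_intervals g h x y : moves g x -> moves h y -> x < y ->
  exists I J : set L, [/\ L_interval I, L_interval J, set_lt I J,
    forall z, I z -> moves g (embed z) & forall z, J z -> moves h (embed z)].
Proof.
move=> gx hy xy; have [m /andP[xm my]] := dedekind_dense xy.
have [l [_ /andP[lx _]]] := dedekind_noends x.
have [_ [r /andP[_ yr]]] := dedekind_noends y.
have [p [q [pq _ qm gI]]] := moves_L_interval gx (introT andP (conj lx xm)).
have [p' [q' [pq' mp _ hI]]] := moves_L_interval hy (introT andP (conj my yr)).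
exists `]p, q[%classic, `]p', q'[%classic; split.
- exact: L_interval_itv.
- exact: L_interval_itv.
- split; [exact: itv_neq0..|move=> a b; rewrite /= !in_itv /=].
  move=> /andP[_ aq] /andP[pb _]; apply: lt_trans aq _.
  by apply: lt_trans pb; rewrite -embed_lt (lt_trans qm).
- by move=> z; rewrite /= in_itv; exact: gI.
- by move=> z; rewrite /= in_itv; exact: hI.
Qed.

Lemma simultaneously_meetC f g u v :
  simultaneously_meet f g u v -> simultaneously_meet g f v u.
Proof. by move=> [k [fu gv]]; exists k. Qed.

(** Each support contains an interval of [L] around the given point, and transitivity applies to
    these intervals. The reversed direction follows by exchanging the roles of the two pairs. *)
Lemma simultaneously_meet_dir c f g u v a b x y :
  moves f a -> moves g b -> moves u x -> moves v y ->
  lt_dir c a b -> lt_dir c x y -> simultaneously_meet f g u v.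
Proof.
have main f' g' u' v' a' b' x' y' :
    moves f' a' -> moves g' b' -> moves u' x' -> moves v' y' ->
    a' < b' -> x' < y' -> simultaneously_meet f' g' u' v'.
  move=> fa gb ux vy ab xy.
  have [I1 [I2 [iI1 iI2 I12 fI gI]]] := moves_L_intervals fa gb ab.
  have [J1 [J2 [iJ1 iJ2 J12 uJ vJ]]] := moves_L_intervals ux vy xy.
  have [k0 [Gk [_ [[z Iz <-] Jz]] [_ [[w Iw <-] Jw]]]] :=
    trans iI1 iI2 iJ1 iJ2 I12 J12.
  pose k : elt G := exist _ k0 Gk.
  exists k; split; apply/(not_disjoint_elts lm).
    exists (act k (embed z)).
      by apply/moves_conj; rewrite actK; exact: fI.
    by rewrite -embed_act; exact: uJ.
  exists (act k (embed w)); first by apply/moves_conj; rewrite actK; exact: gI.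
  by rewrite -embed_act; exact: vJ.
case: c => fa gb ux vy ab xy; first exact: main ab xy.
by apply: simultaneously_meetC; exact: main ab xy.
Qed.

Definition before c f g := forall x y, moves f x -> moves g y -> lt_dir c x y.

Lemma beforeN c f g : before (~~ c) f g <-> before c g f.
Proof.
by split=> fg x y mx my; have := fg _ _ my mx; rewrite lt_dirN.
Qed.

Lemma before_excl c f g : f <> 1 -> g <> 1 ->
  before c f g -> before c g f -> False.
Proof.
move=> /neq1_moves[x fx] /neq1_moves[y gy] fg gf.
exact: lt_dir_irr (lt_dir_trans (fg _ _ fx gy) (gf _ _ gy fx)).
Qed.

(** Elements of [G] preserve the order, so the two common points would be ordered in both ways. *)
Lemma before_not_meet c f g u v : before c f g -> before c v u ->
  ~ simultaneously_meet f g u v.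
Proof.
move=> fg vu [k [/(not_disjoint_elts lm)[x fx ux]]].
move=> /(not_disjoint_elts lm)[y gy vy].
have := fg _ _ ((moves_conj k f x).1 fx) ((moves_conj k g y).1 gy).
have := vu _ _ vy ux.
case: c {fg vu}; rewrite /lt_dir act_lt => yx xy.
  by have := lt_trans xy yx; rewrite ltxx.
by have := lt_trans xy yx; rewrite ltxx.
Qed.

Lemma exists_before c : exists u v, (u <> 1 /\ v <> 1) /\ before c u v.
Proof.
have [x0 _] := @chain_nontrivial _ L.
have [y0 xy] := chain_nomax x0; have [z0 yz] := chain_nomax y0.
rewrite -embed_lt in xy; rewrite -embed_lt in yz.
have [u u1 uI] := lm xy; have [v v1 vI] := lm yz.
have uv : before true u v.
  by move=> a b /uI/andP[_ ay] /vI/andP[yb _]; exact: lt_trans yb.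
case: c; first by exists u, v.
by exists v, u; split => //; apply/(beforeN false).
Qed.

(** Comparable [f], [g] cannot meet a pair placed in the opposite order. Incomparable ones have
    points in both orders and so meet every nontrivial pair. *)
Lemma separated_eltsP f g :
  separated_elts f g <-> (f <> 1 /\ g <> 1) /\ exists c, before c f g.
Proof.
split=> -[fg1]; last first.
  move=> [c fg]; split => //; have [u [v [[u1 v1] uv]]] := exists_before c.
  by exists v, u; split => //; exact: before_not_meet uv.
move=> [u [v [[u1 v1] nm]]]; split => //; apply: contrapT => nb.
(* Otherwise no point for [f] strictly precedes one for [g] in direction [c]; the point [b'] past
   [b] also rules out equality, so the supports are comparable. *)
have cross c : exists a b, [/\ moves f a, moves g b & lt_dir c a b].
  apply: contrapT => nab; apply: nb; exists (~~ c) => a b fa gb.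
  have [b' gb' bb'] := moves_near_dir c gb; rewrite lt_dirN.
  have [ab'|] := le_dir_total c a b; last first.
    move=> ba; have [//|//] : lt_dir c b a \/ b = a.
      by case: (c) ba; rewrite /le_dir le_eqVlt => /predU1P[]; auto.
    by move=> ba'; case: nab; exists a, b'; split => //; rewrite -ba'.
  by case: nab; exists a, b'; split => //; exact: le_lt_dir bb'.
apply: nm; have [x ux] := neq1_moves u1; have [y0 vy0] := neq1_moves v1.
(* The direction is dictated by [u] and [v]; should the two chosen points coincide, openness
   provides another point for [v]. *)
have [c [y vy xy]] : exists c, exists2 y, moves v y & lt_dir c x y.
  have [xy|yx|xy] := ltgtP x y0.
  - by exists true, y0.
  - by exists false, y0.
  - have [y vy yy] := moves_near_dir true vy0.
    by exists true, y => //; rewrite xy.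
have [a [b [fa gb ab]]] := cross c.
exact: (simultaneously_meet_dir fa gb ux vy ab xy).
Qed.

Lemma same_directionP c f g r s : r <> 1 -> s <> 1 -> before c r s ->
  same_direction f g r s <-> (f <> 1 /\ g <> 1) /\ before c f g.
Proof.
move=> r1 s1 rs; split=> [[[/separated_eltsP[fg1 [c' fg]] _] m]|].
  split => //; have [<-//|cc'] := eqVneq c' c.
  have {}fg : before (~~ c) f g by move: fg; case: (c) (c') cc' => -[].
  by case: (before_not_meet fg _ m); apply/beforeN.
move=> [[f1 g1] fg].
split; first by split; apply/separated_eltsP; split => //; exists c.
have [a fa] := neq1_moves f1; have [b gb] := neq1_moves g1.
have [x rx] := neq1_moves r1; have [y sy] := neq1_moves s1.
exact: (simultaneously_meet_dir fa gb rx sy (fg _ _ fa gb) (rs _ _ rx sy)).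
Qed.

Definition codes f g x :=
  (f <> 1 /\ g <> 1) /\ exists c, before c f g /\ is_inf c (moves g) x.

Lemma codes_separated_elts f g x : codes f g x -> separated_elts f g.
Proof.
by move=> [fg1 [c [fg _]]]; apply/separated_eltsP; split => //; exists c.
Qed.

Lemma locally_moving_dir c x y : lt_dir c x y -> exists2 e : elt G, e <> 1 &
  forall z, moves e z -> lt_dir c x z /\ lt_dir c z y.
Proof.
case: c => /= /lm[e e1 eI]; exists e => // z /eI/andP[] //.
Qed.

Lemma beforeE c f g x : is_inf c (moves g) x ->
  before c f g <-> forall y, moves f y -> le_dir c y x.
Proof.
move=> [lx gx]; split=> [fg y fy|fx y z fy gz].
  by apply: gx => z gz; apply: lt_dirW; exact: fg.
have [y' fy' yy'] := moves_near_dir c fy.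
by apply: lt_le_dir yy' _; apply: le_dir_trans (fx _ fy') _; exact: lx.
Qed.

(** The disjuncts of [after] match the two directions of the code. If it points along [c], then [x]
    is where the support of [g] begins, and [e] lies after [x] when all that precedes [g] precedes
    [e]. If it points against [c], then [x] is where that support ends, and [e] just has to come
    after [g]. *)
Lemma afterP c e f g r s x : codes f g x -> r <> 1 -> s <> 1 -> before c r s ->
  after e f g r s <-> e <> 1 /\ is_lower c (moves e) x.
Proof.
move=> [[f1 g1] [c0 [fg gx]]] r1 s1 rs.
have sd e' h := same_directionP e' h r1 s1 rs.
have sd0 e' h := same_directionP e' h f1 g1 fg.
have [cc0|cc0] := eqVneq c0 c.
  subst c0; split=> [[[_ ef]|[/sd[_ gf] _]]|[e1 ex]]; last 2 first.
  - by case: (before_excl f1 g1 fg gf).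
  - left; split; first exact/sd.
    move=> e' /sd0[[e'1 _] e'g]; apply/sd0; split => // y z e'y ez.
    have [y' e'y' yy'] := moves_near_dir c e'y.
    apply: lt_le_dir yy' _; apply: le_dir_trans (ex _ ez).
    exact: (beforeE _ gx).1 e'g _ e'y'.
  (* Instantiating [beyond] at [f] itself shows that [e] is nontrivial. *)
  have e1 : e <> 1.
    by have /sd0[[]] := ef f ((sd0 f g).2 (conj (conj f1 g1) fg)).
  split=> // z ez; apply: contrapT => /not_le_dir zx.
  (* An element supported between [z] and [x] precedes [g] but not [e], against [beyond]. *)
  have [e' e'1 e'I] := locally_moving_dir zx.
  have /ef/sd0[_ e'e] : same_direction e' g f g.
    apply/sd0; split=> //; apply/(beforeE _ gx) => y /e'I[_].
    exact: lt_dirW.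
  have [y e'y] := neq1_moves e'1; have [zy _] := e'I _ e'y.
  exact: lt_dir_irr (lt_dir_trans zy (e'e _ _ e'y ez)).
have {cc0} cc0 : c0 = ~~ c by case: c0 c cc0 {fg gx rs sd sd0} => -[].
subst c0; have gf := (beforeN c f g).1 fg.
have lowerE : is_lower c (moves e) x <-> before (~~ c) e g.
  by rewrite (beforeE e gx); split=> h y ey; have := h y ey; rewrite le_dirN.
split=> [[[/sd[_ fg'] _]|[_ /sd0[[e1 _] eg]]]|[e1 ex]].
- by case: (before_excl f1 g1 fg' gf).
- by split => //; apply/lowerE.
- by right; split; [exact/sd|apply/sd0; split => //; apply/lowerE].
Qed.

(** The witness [e] has its support between the two points; being open and nonempty, that support
    forces a strict inequality. Conversely, local movement puts an [e] between distinct points. *)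
Lemma precedesP c f1 g1 f2 g2 r s x1 x2 :
  codes f1 g1 x1 -> codes f2 g2 x2 -> r <> 1 -> s <> 1 -> before c r s ->
  precedes f1 g1 f2 g2 r s <-> lt_dir c x1 x2.
Proof.
move=> c1 c2 r1 s1 rs; have sr : before (~~ c) s r by apply/beforeN.
have A1 e := afterP e c1 r1 s1 rs; have A2 e := afterP e c2 s1 r1 sr.
split=> [[e [/A1[e1 ex1] /A2[_ ex2]]]|/locally_moving_dir[e e1 eI]]; last first.
  exists e; split; [apply/A1|apply/A2]; split => // y /eI[? ?].
    exact: lt_dirW.
  by rewrite le_dirN; exact: lt_dirW.
have [y ey] := neq1_moves e1; have [y' ey' yy'] := moves_near_dir c ey.
apply: le_lt_dir (ex1 _ ey) _; apply: lt_le_dir yy' _.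
by rewrite -le_dirN; exact: ex2.
Qed.

Lemma codes_equalP f1 g1 f2 g2 x1 x2 :
  codes f1 g1 x1 -> codes f2 g2 x2 -> codes_equal f1 g1 f2 g2 <-> x1 = x2.
Proof.
move=> c1 c2; split=> [ne|x12]; last first.
  move=> [r [s [/separated_eltsP[[r1 s1] [c rs]]]]].
  by move=> /(precedesP c1 c2 r1 s1 rs); rewrite x12 => /lt_dir_irr.
have [r [s [[r1 s1] rs]]] := exists_before true.
have [s' [r' [[s1' r1'] rs']]] := exists_before false.
have [x12|x21|//] := ltgtP x1 x2; case: ne.
  exists r, s; split; first by apply/separated_eltsP; split => //; exists true.
  exact: ((precedesP c1 c2 r1 s1 rs).2 x12).
exists s', r'; split; first by apply/separated_eltsP; split => //; exists false.
exact: ((precedesP c1 c2 s1' r1' rs').2 x21).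
Qed.

End Transitive.

(** * Interpretation of the action on endpoints *)

Section EndPoints.
Context d (L : chainType d) (G : groupClosed (Aut L)).
Local Notation T := (dedekind L).
Implicit Types (f g h : elt G) (x y : T) (X : set T).

Lemma nbhs_moves g x : moves g x -> nbhs x (moves g).
Proof.
move=> gx; have [l [r lxr]] := dedekind_noends x.
have [p [q [pxq _ _ dg]]] := displaces_near gx lxr.
have : nbhs x `]p, q[%classic.
  by apply: open_nbhs_nbhs; split; [exact: itv_open|rewrite /= in_itv].
apply: (@filterS _ (nbhs x)) => y; rewrite /= in_itv; exact: displaces_moves.
Qed.

Lemma moves_var g : (moves g `<=` var (val g))%classic.
Proof.
by move=> x /nbhs_moves; apply: (@filterS _ (nbhs x)); exact: subset_closure.
Qed.

Lemma lbound_hull X : lbound (convex_hull X) = lbound X.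
Proof.
rewrite eqEsubset; split=> x lx y Xy.
  by apply: lx; exists y, y; rewrite lexx.
by have [a [b [Xa _ /andP[ay _]]]] := Xy; exact: le_trans (lx _ Xa) ay.
Qed.

Lemma ubound_hull X : ubound (convex_hull X) = ubound X.
Proof.
rewrite eqEsubset; split=> x lx y Xy.
  by apply: lx; exists y, y; rewrite lexx.
by have [a [b [_ Xb /andP[_ yb]]]] := Xy; exact: le_trans yb (lx _ Xb).
Qed.

Lemma lbound_var g : lbound (var (val g)) = lbound (moves g).
Proof.
rewrite eqEsubset; split=> x lx y; first by move=> /moves_var; exact: lx.
move=> /interior_subset; rewrite closureE => cy.
have : (`[x, +oo[%classic : set T) y.
  apply: cy; split; first exact: rray_closed.
  by move=> z /lx; rewrite /= in_itv andbT.
by rewrite /= in_itv andbT.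
Qed.

Lemma ubound_var g : ubound (var (val g)) = ubound (moves g).
Proof.
rewrite eqEsubset; split=> x lx y; first by move=> /moves_var; exact: lx.
move=> /interior_subset; rewrite closureE => cy.
have : (`]-oo, x]%classic : set T) y.
  by apply: cy; split; [exact: lray_closed|move=> z /lx; rewrite /= in_itv].
by rewrite /= in_itv.
Qed.

(** Convex hulls do not change bounds. Nor does passing to [var], since closed rays absorb the
    closure and the open support lies in its interior. *)
Lemma EpE g x : Ep (val g) x <-> exists c, is_inf c (moves g) x.
Proof.
rewrite /Ep /infimums /supremums lbound_hull ubound_hull lbound_var ubound_var.
split=> [[]|[[]]]; [by exists true|by exists false|by left|by right].
Qed.

Lemma is_inf_exists c X : (X !=set0)%classic -> (exists z, is_lower c X z) ->
  exists x, is_inf c X x.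
Proof.
case: c => [[y Xy] [z lz]|X0 [z uz]]; last first.
  have [|x [ux lx]] := @dedekind_complete _ _ X; last by exists x.
  by split=> //; exists z.
have [|x [ux lx]] := @dedekind_complete _ _ (lbound X).
  by split; [exists z|exists y => a; exact].
by exists x; split=> // b Xb; apply: lx => a; exact.
Qed.

Hypothesis lm : locally_moving G.

Lemma codes_Ep f g x : codes f g x -> x \in Ep_group G.
Proof.
move=> [_ [c [_ gx]]]; apply/mem_set; exists (val g); first exact: valP.
by apply/EpE; exists c.
Qed.

Lemma Ep_codes x : x \in Ep_group G -> exists f g, codes f g x.
Proof.
move=> /set_mem[g0 Gg0 gx]; pose g : elt G := exist _ g0 Gg0.
have [c {}gx] := (EpE g x).1 gx.
have [y yx] := exists_lt_dir (~~ c) x.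
rewrite lt_dirN in yx; have [f f1 fI] := locally_moving_dir lm yx.
exists f, g; split; last first.
  exists c; split => //; apply/(beforeE _ gx) => z /fI[_]; exact: lt_dirW.
(* An empty support would be bounded by every point and so have no extremal bound. *)
split=> // g1.
have [z xz] := exists_lt_dir c x.
have zx : le_dir c z x by apply: gx.2 => a; rewrite g1 => /(_ (act1 G a)).
exact: lt_dir_irr (lt_le_dir xz zx).
Qed.

Lemma moves_conj_act h g x : moves (h * g * h^-1) (act h x) <-> moves g x.
Proof. by rewrite moves_conj actK. Qed.

Lemma le_dir_act c h x y : le_dir c (act h x) (act h y) = le_dir c x y.
Proof. by case: c; rewrite /le_dir act_le. Qed.

Lemma lt_dir_act c h x y : lt_dir c (act h x) (act h y) = lt_dir c x y.
Proof. by case: c; rewrite /lt_dir act_lt. Qed.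

Lemma conj_neq1 h g : g <> 1 -> h * g * h^-1 <> 1.
Proof. by move=> /neq1_moves[x] /(moves_conj_act h g x)/moves_neq1. Qed.

Lemma before_conj c h f g :
  before c f g -> before c (h * f * h^-1) (h * g * h^-1).
Proof.
move=> fg x y /moves_conj fx /moves_conj gy.
by rewrite -(lt_dir_act c h^-1); exact: fg.
Qed.

Lemma is_inf_conj c h g x :
  is_inf c (moves g) x -> is_inf c (moves (h * g * h^-1)) (act h x).
Proof.
move=> [lx gx]; split=> y.
  by move=> /moves_conj gy; rewrite -[y](actVK h) le_dir_act; exact: lx.
move=> ly; rewrite -[y](actVK h) le_dir_act; apply: gx => z gz.
by rewrite -(le_dir_act c h) actVK; apply: ly; exact/moves_conj_act.
Qed.

(** This makes the application of [h] to a point expressible on codes. *)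
Lemma codes_conj h f g x : codes f g x ->
  codes (h * f * h^-1) (h * g * h^-1) (act h x).
Proof.
move=> [[f1 g1] [c [fg gx]]]; split; first by split; exact: conj_neq1.
by exists c; split; [exact: before_conj|exact: is_inf_conj].
Qed.

Hypothesis trans : two_interval_transitive G.

Lemma codes_equidirectedP f1 g1 f2 g2 f3 g3 f4 g4 x1 x2 x3 x4 :
  codes f1 g1 x1 -> codes f2 g2 x2 -> codes f3 g3 x3 -> codes f4 g4 x4 ->
  codes_equidirected f1 g1 f2 g2 f3 g3 f4 g4 <->
  (x1 < x2 /\ x3 < x4) \/ (x1 > x2 /\ x3 > x4).
Proof.
move=> c1 c2 c3 c4; split.
  move=> [r [s [/(separated_eltsP trans lm)[[r1 s1] [c rs]]]]].
  rewrite (precedesP trans lm c1 c2 r1 s1 rs).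
  rewrite (precedesP trans lm c3 c4 r1 s1 rs).
  by case: c {rs} => -[]; [left|right].
suff main c : lt_dir c x1 x2 -> lt_dir c x3 x4 ->
    codes_equidirected f1 g1 f2 g2 f3 g3 f4 g4.
  by case=> -[]; [exact: (main true)|exact: (main false)].
move=> x12 x34; have [r [s [[r1 s1] rs]]] := exists_before lm c.
exists r, s; split.
  by apply/(separated_eltsP trans lm); split => //; exists c.
split; first exact: ((precedesP trans lm c1 c2 r1 s1 rs).2 x12).
exact: ((precedesP trans lm c3 c4 r1 s1 rs).2 x34).
Qed.

Lemma separated_elts_codes f g : separated_elts f g -> exists x, codes f g x.
Proof.
move=> /(separated_eltsP trans lm)[[f1 g1] [c fg]].
have [y gy] := neq1_moves g1; have [z fz] := neq1_moves f1.
have [||x gx] := @is_inf_exists c (moves g).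
- by exists y.
- by exists z => a ga; apply: lt_dirW; exact: fg.
by exists x; split => //; exists c.
Qed.

(** The boolean [s] is the sort, fixed outside the group language. Points and group elements are
    both represented by pairs, to be treated uniformly; for a group element the second component is
    arbitrary. *)
Definition represents (s : bool) f g (w : ACT_EP G) : Prop :=
  match w with
  | inl x => s = true /\ codes f g (val x)
  | inr h => s = false /\ f = h
  end.

End EndPoints.

(** * Translation of formulas on the action into group formulas *)

Lemma relational_term_var (R : Type) (arity : R -> nat) n
    (t : term (relational arity) n) :
  exists i, t = Var _ i.
Proof. by case: t => [i|[]]; exists i. Qed.

(** Conditions on the sorts of variables do not depend on the group, so classically each is a true
    or a false formula. *)
Lemma definable_const n (Q : Prop) : definable (fun H (v : 'I_n -> H) => Q).
Proof.
have [q|nq] := EM Q; last by exists (FFalse _ _).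
by exists (FImp (FFalse _ _) (FFalse _ _)) => H v; split=> // _ [].
Qed.

Lemma definable_exists_extend n
    (P : forall H : groupType, ('I_n.+1 -> H) -> Prop) :
  definable P -> definable (fun H v => exists x, P H (extend x v)).
Proof.
move=> [p hp]; exists (FEx p) => H v /=.
by split=> -[x hx]; exists x; move: hx; rewrite hp.
Qed.

Lemma definable_forall_extend n
    (P : forall H : groupType, ('I_n.+1 -> H) -> Prop) :
  definable P -> definable (fun H v => forall x, P H (extend x v)).
Proof.
move=> [p hp]; exists (FAll p) => H v /=.
by split=> hx x; have := hx x; rewrite hp.
Qed.

(** One quantifier over the two-sorted universe becomes two over the group, so older indices move up
    by two. The new first component gets index [lift ord0 ord0]; the second, bound last, gets
    [ord0]. *)
Definition code_index n m (a : 'I_n -> 'I_m) (i : 'I_m.+2) :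
    'I_n.+1 -> 'I_m.+2 :=
  extend i (fun j => lift ord0 (lift ord0 (a j))).

Lemma represents_extend d (L : chainType d) (G : groupClosed (Aut L)) n m
    (s : 'I_n -> bool) (a b : 'I_n -> 'I_m) (v : 'I_m -> elt G)
    (w : 'I_n -> ACT_EP G) sx f g (x : ACT_EP G) :
  (forall i, represents (s i) (v (a i)) (v (b i)) (w i)) ->
  represents sx f g x ->
  forall i, represents (extend sx s i)
    (extend g (extend f v) (code_index a (lift ord0 ord0) i))
    (extend g (extend f v) (code_index b ord0 i)) (extend x w i).
Proof.
move=> hw hx i; case: (unliftP ord0 i) => [k|] ->; rewrite /code_index.
  by rewrite !extend_lift.
by rewrite !extend0 extend_lift extend0.
Qed.

(* The variable [i] of [p] is represented by the variables [a i] and [b i]: they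
   code a point if [s i], and otherwise [a i] is a group element. *)
Lemma translation n (p : formula (relational (act_arity EP_arity)) n)
    m (s : 'I_n -> bool) (a b : 'I_n -> 'I_m) :
  exists2 P : forall H : groupType, ('I_m -> H) -> Prop, definable P &
    forall d (L : chainType d) (G : groupClosed (Aut L)),
      two_interval_transitive G -> locally_moving G ->
      forall (v : 'I_m -> elt G) (w : 'I_n -> ACT_EP G),
        (forall i, represents (s i) (v (a i)) (v (b i)) (w i)) ->
        P (elt G) v <-> holds p w.
Proof.
elim: p m s a b => {n}.
- move=> n t u m s a b; have [i ->] := relational_term_var t.
  have [j ->] := relational_term_var u.
  case si: (s i); case sj: (s j).
  + exists (fun H v => codes_equal (v (a i)) (v (b i)) (v (a j)) (v (b j))).
      by apply: definable_codes_equal; exact: term_definable_var.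
    move=> d L G trans lm v w hw /=; have := hw i; have := hw j; rewrite si sj.
    case: (w j) => [y [_ cy]|h [//]]; case: (w i) => [x [_ cx]|h [//]].
    rewrite (codes_equalP trans lm cx cy).
    by split=> [/val_inj ->//|[->]].
  + exists (fun H v => False); first exact: definable_False.
    move=> d L G trans lm v w hw /=; have := hw i; have := hw j; rewrite si sj.
    by case: (w j) => [y []//|h _]; case: (w i) => [x _|h' []//]; split.
  + exists (fun H v => False); first exact: definable_False.
    move=> d L G trans lm v w hw /=; have := hw i; have := hw j; rewrite si sj.
    by case: (w j) => [y _|h []//]; case: (w i) => [x []//|h' _]; split.
  + exists (fun H v => v (a i) = v (a j)).
      by apply: definable_eq; exact: term_definable_var.
    move=> d L G trans lm v w hw /=; have := hw i; have := hw j; rewrite si sj.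
    case: (w j) => [y []//|h [_ ->]]; case: (w i) => [x []//|h' [_ ->]].
    by split=> [->|[]].
- move=> n r args m s a b.
  have /choice[j jE] := fun i => relational_term_var (args i).
  have {jE} -> : args = fun i => Var _ (j i) by apply/funext.
  case: r args j => [[]||||] args /= j.
  + pose k0 : 'I_4 := Ordinal (isT : 0 < 4)%N.
    pose k1 : 'I_4 := Ordinal (isT : 1 < 4)%N.
    pose k2 : 'I_4 := Ordinal (isT : 2 < 4)%N.
    pose k3 : 'I_4 := Ordinal (isT : 3 < 4)%N.
    exists (fun H v => (forall k, s (j k) = true) /\ codes_equidirected
        (v (a (j k0))) (v (b (j k0))) (v (a (j k1))) (v (b (j k1)))
        (v (a (j k2))) (v (b (j k2))) (v (a (j k3))) (v (b (j k3)))).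
      apply: definable_and; first exact: definable_const.
      by apply: definable_codes_equidirected; exact: term_definable_var.
    move=> d L G trans lm v w hw /=; split.
      move=> [sj eqd]; have /choice[x xE] : forall k, exists x : EP_point G,
          w (j k) = inl x /\ codes (v (a (j k))) (v (b (j k))) (val x).
        move=> k; have := hw (j k); rewrite sj.
        by case: (w (j k)) => [x [_ cx]|h []//]; exists x.
      exists x; first by move=> k; have [] := xE k.
      exact: ((codes_equidirectedP lm trans (xE k0).2 (xE k1).2 (xE k2).2
        (xE k3).2).1 eqd).
    move=> [x xE rx]; have sx k : s (j k) = true /\
        codes (v (a (j k))) (v (b (j k))) (val (x k)).
      by have := hw (j k); rewrite xE.
    split; first by move=> k; have [] := sx k.
    exact: ((codes_equidirectedP lm trans (sx k0).2 (sx k1).2 (sx k2).2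
      (sx k3).2).2 rx).
  + pose j0 := arg j (isT : 0 < 3)%N; pose j1 := arg j (isT : 1 < 3)%N.
    pose j2 := arg j (isT : 2 < 3)%N.
    exists (fun H v => [/\ s j0 = false, s j1 = false & s j2 = false] /\
        v (a j0) * v (a j1) = v (a j2)).
      apply: definable_and; first exact: definable_const.
      by apply: definable_eq; definability.
    move=> d L G trans lm v w hw /=.
    have := hw j0; have := hw j1; have := hw j2.
    rewrite /arg -!/(arg j _) -/j0 -/j1 -/j2.
    case: (w j2) => [x2|h2] /= [-> e2].
      by move=> _ _; split=> [[[]]|[? [? []]]].
    case: (w j1) => [x1|h1] /= [-> e1].
      by move=> _; split=> [[[]]|[? [? []]]].
    case: (w j0) => [x0|h0] /= [-> e0].
      by split=> [[[]]|[? [? []]]].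
    rewrite e0 e1 e2; split=> [[_ <-]|]; first by exists h0, h1.
    by move=> [g [h [[->] [->] [->]]]].
  + pose j0 := arg j (isT : 0 < 3)%N; pose j1 := arg j (isT : 1 < 3)%N.
    pose j2 := arg j (isT : 2 < 3)%N.
    (* The image of a coded point is coded by the conjugate pair, and equality of points becomes
       equality of codes. *)
    exists (fun H v => [/\ s j0 = false, s j1 = true & s j2 = true] /\
        codes_equal (v (a j0) * v (a j1) * (v (a j0))^-1)
          (v (a j0) * v (b j1) * (v (a j0))^-1) (v (a j2)) (v (b j2))).
      apply: definable_and; first exact: definable_const.
      by apply: definable_codes_equal; definability.
    move=> d L G trans lm v w hw /=.
    have := hw j0; have := hw j1; have := hw j2.
    rewrite /arg -!/(arg j _) -/j0 -/j1 -/j2.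
    case: (w j2) => [x2|h2] /= [-> c2]; last first.
      by move=> _ _; split=> [[[]]|[? [? []]]].
    case: (w j1) => [x1|h1] /= [-> c1]; last first.
      by move=> _; split=> [[[]]|[? [? []]]].
    case: (w j0) => [x0|h0] /= [-> e0].
      by split=> [[[]]|[? [? []]]].
    rewrite e0 (codes_equalP trans lm (codes_conj h0 c1) c2).
    split=> [[_ x12]|[h [x [[->] [->] [->]]]]]; last by split.
    exists h0, x1; split => //; congr inl; exact/esym/val_inj.
  + pose j0 := arg j (isT : 0 < 1)%N.
    exists (fun H v => s j0 = true); first exact: definable_const.
    move=> d L G trans lm v w hw /=; have := hw j0.
    rewrite /arg -/(arg j _) -/j0.
    case: (w j0) => [x [-> _]|h [-> _]]; split => //; first by exists x.
    by case.
  + pose j0 := arg j (isT : 0 < 1)%N.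
    exists (fun H v => s j0 = false); first exact: definable_const.
    move=> d L G trans lm v w hw /=; have := hw j0.
    rewrite /arg -/(arg j _) -/j0.
    case: (w j0) => [x [-> _]|h [-> _]]; split => //; last by exists h.
    by case.
- move=> n m s a b; exists (fun H v => False); first exact: definable_False.
  by [].
- move=> n p IHp q IHq m s a b.
  have [P dP hP] := IHp m s a b; have [Q dQ hQ] := IHq m s a b.
  exists (fun H v => P H v /\ Q H v); first exact: definable_and.
  move=> d L G trans lm v w hw /=.
  by rewrite (hP _ _ _ trans lm v w hw) (hQ _ _ _ trans lm v w hw).
- move=> n p IHp q IHq m s a b.
  have [P dP hP] := IHp m s a b; have [Q dQ hQ] := IHq m s a b.
  exists (fun H v => P H v \/ Q H v); first exact: definable_or.
  move=> d L G trans lm v w hw /=.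
  by rewrite (hP _ _ _ trans lm v w hw) (hQ _ _ _ trans lm v w hw).
- move=> n p IHp q IHq m s a b.
  have [P dP hP] := IHp m s a b; have [Q dQ hQ] := IHq m s a b.
  exists (fun H v => P H v -> Q H v); first exact: definable_imp.
  move=> d L G trans lm v w hw /=.
  by rewrite (hP _ _ _ trans lm v w hw) (hQ _ _ _ trans lm v w hw).
- move=> n p IH m s a b.
  pose a' := code_index a (lift ord0 ord0); pose b' := code_index b ord0.
  have [P dP hP] := IH _ (extend true s) a' b'.
  have [Q dQ hQ] := IH _ (extend false s) a' b'.
  (* The new element is either a point, and then [separated_elts] delimits the pairs that code one,
     or a group element, and then only [f] matters. *)
  exists (fun H v => forall f, forall g,
      (separated_elts (extend g (extend f v) (lift ord0 ord0))
        (extend g (extend f v) ord0) -> P H (extend g (extend f v))) /\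
      Q H (extend g (extend f v))).
    have dR : definable (fun H (u : 'I_m.+2 -> H) =>
        (separated_elts (u (lift ord0 ord0)) (u ord0) -> P H u) /\ Q H u).
      apply: definable_and => //; apply: definable_imp => //.
      by apply: definable_separated_elts; exact: term_definable_var.
    exact: (definable_forall_extend (definable_forall_extend dR)).
  move=> d L G trans lm v w hw /=; split=> h.
    move=> [x|f].
      have [f [g fgx]] := Ep_codes lm (valP x); have [hPfg _] := h f g.
      have hx : represents true f g (inl x) by [].
      have hw' := represents_extend hw hx.
      apply/(hP _ _ _ trans lm _ _ hw'); apply: hPfg.
      by rewrite extend_lift !extend0; exact: codes_separated_elts fgx.
    have hx : represents false f (1 : elt G) (inr f) by [].
    have hw' := represents_extend hw hx.
    by apply/(hQ _ _ _ trans lm _ _ hw'); have [] := h f 1.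
  move=> f g; rewrite extend_lift !extend0; split.
    move=> /(separated_elts_codes lm trans)[x fgx].
    pose x' : EP_point G := exist _ x (codes_Ep fgx).
    have hx : represents true f g (inl x') by [].
    exact/(hP _ _ _ trans lm _ _ (represents_extend hw hx)).
  have hx : represents false f g (inr f) by [].
  exact/(hQ _ _ _ trans lm _ _ (represents_extend hw hx)).
- move=> n p IH m s a b.
  pose a' := code_index a (lift ord0 ord0); pose b' := code_index b ord0.
  have [P dP hP] := IH _ (extend true s) a' b'.
  have [Q dQ hQ] := IH _ (extend false s) a' b'.
  exists (fun H v => exists f, exists g,
      (separated_elts (extend g (extend f v) (lift ord0 ord0))
        (extend g (extend f v) ord0) /\ P H (extend g (extend f v))) \/
      Q H (extend g (extend f v))).
    have dR : definable (fun H (u : 'I_m.+2 -> H) =>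
        (separated_elts (u (lift ord0 ord0)) (u ord0) /\ P H u) \/ Q H u).
      apply: definable_or => //; apply: definable_and => //.
      by apply: definable_separated_elts; exact: term_definable_var.
    exact: (definable_exists_extend (definable_exists_extend dR)).
  move=> d L G trans lm v w hw /=; split.
    move=> [f [g]]; rewrite extend_lift !extend0 => -[[]|hq].
      move=> /(separated_elts_codes lm trans)[x fgx] hp.
      pose x' : EP_point G := exist _ x (codes_Ep fgx).
      have hx : represents true f g (inl x') by [].
      exists (inl x').
      exact/(hP _ _ _ trans lm _ _ (represents_extend hw hx)).
    have hx : represents false f g (inr f) by [].
    exists (inr f); exact/(hQ _ _ _ trans lm _ _ (represents_extend hw hx)).
  move=> [[x|f] hp].
    have [f [g fgx]] := Ep_codes lm (valP x).
    have hx : represents true f g (inl x) by [].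
    exists f, g; rewrite extend_lift !extend0; left; split.
      exact: codes_separated_elts fgx.
    exact/(hP _ _ _ trans lm _ _ (represents_extend hw hx)).
  have hx : represents false f (1 : elt G) (inr f) by [].
  exists f, 1; right; exact/(hQ _ _ _ trans lm _ _ (represents_extend hw hx)).
Qed.

(** The translated sentence is chosen before the chain and the group, so the same group sentence
    serves both sides. *)
Lemma elem_equiv_ACT_EP d1 d2 (L1 : chainType d1) (L2 : chainType d2)
    (G1 : groupClosed (Aut L1)) (G2 : groupClosed (Aut L2)) :
  two_interval_transitive G1 -> locally_moving G1 ->
  two_interval_transitive G2 -> locally_moving G2 ->
  elem_equiv (group_structure (elt G1)) (group_structure (elt G2)) ->
  elem_equiv (ACT_EP G1) (ACT_EP G2).
Proof.
move=> trans1 lm1 trans2 lm2 G12 p v w.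
(* A sentence has no free variables: sorts, index maps and valuations are all defined on the empty
   type ['I_0]. *)
have [P [q hq] hP] := translation p (fun=> true) id id.
have h1 := hP _ _ _ trans1 lm1 (fun=> 1) v.
have h2 := hP _ _ _ trans2 lm2 (fun=> 1) w.
rewrite -h1 => [|[]//]; rewrite -h2 => [|[]//].
rewrite -!hq; exact: G12.
Qed.

(** * Reconstruction of the completion *)

Section Points.
Context d (L : chainType d) (G : groupClosed (Aut L)).
Local Notation T := (dedekind L).
Implicit Types (f g h : elt G) (x y : T) (c : bool).

Lemma is_lower_conj c h f x :
  is_lower c (moves (h * f * h^-1)) x <-> is_lower c (moves f) (act h^-1 x).
Proof.
split=> lx y fy.
  rewrite -(le_dir_act c h) actVK; apply: lx.
  exact/(moves_conj_act h f y).
by rewrite -(le_dir_act c h^-1); apply: lx; exact/moves_conj.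
Qed.

Hypothesis lm : locally_moving G.

(** Were [y] strictly before [x], the support of an element placed between them would be bounded by
    [y] but not by [x]. So points are compared, and identified, through the supports they bound. *)
Lemma is_lower_le c x y :
  (forall f, f <> 1 -> is_lower c (moves f) y -> is_lower c (moves f) x) ->
  le_dir c x y.
Proof.
move=> xy; apply: contrapT => /not_le_dir yx.
have [f f1 fI] := locally_moving_dir lm yx.
have [z fz] := neq1_moves f1; have [_ zx] := fI _ fz.
apply: (lt_dir_irr (lt_le_dir zx _)); apply: xy fz => // a /fI[ya _].
exact: lt_dirW.
Qed.

Lemma is_lower_inj c x y :
  (forall f, f <> 1 -> is_lower c (moves f) x <-> is_lower c (moves f) y) ->
  x = y.
Proof.
move=> xy; apply: (@le_dir_anti _ _ c);
  by apply: is_lower_le => f f1 /xy; apply.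
Qed.

End Points.

Section Transport.
Context d1 d2 (L1 : chainType d1) (L2 : chainType d2).
Context (G1 : groupClosed (Aut L1)) (G2 : groupClosed (Aut L2)).
Variables (c1 c2 : bool) (phi : elt G1 -> elt G2).
Hypotheses (lm1 : locally_moving G1) (phi1 : forall f, f <> 1 -> phi f <> 1).
Hypothesis phi_before : forall f g, f <> 1 -> g <> 1 ->
  before c1 f g <-> before c2 (phi f) (phi g).

(** The image [y] is the infimum in direction [c2] of the image supports of all elements lying after
    [x]; the images of elements lying before [x] provide lower bounds. *)
Lemma transport_point (x : dedekind L1) : exists y : dedekind L2,
  forall f, f <> 1 ->
    is_lower c1 (moves f) x <-> is_lower c2 (moves (phi f)) y.
Proof.
pose X := [set y | exists f,
  [/\ f <> 1, is_lower c1 (moves f) x & moves (phi f) y]]%classic.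
have below f : f <> 1 -> (forall z, moves f z -> lt_dir c1 z x) ->
    forall z, moves (phi f) z -> is_lower c2 X z.
  move=> f1 fx z fz y [h [h1 hx hy]]; apply: lt_dirW.
  apply: ((phi_before f1 h1).1 _ _ _ fz hy) => a b fa hb.
  exact: lt_le_dir (fx _ fa) (hx _ hb).
have [||y0 [ly gy]] := @is_inf_exists _ _ c2 X.
- have [y xy] := exists_lt_dir c1 x.
  have [f f1 fI] := locally_moving_dir lm1 xy.
  have [z fz] := neq1_moves (phi1 f1); exists z, f; split => // a /fI[xa _].
  exact: lt_dirW.
- have [y xy] := exists_lt_dir (~~ c1) x; rewrite lt_dirN in xy.
  have [f f1 fI] := locally_moving_dir lm1 xy.
  have [z fz] := neq1_moves (phi1 f1).
  by exists z; apply: (below f) => // a /fI[].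
exists y0 => f f1; split=> [fx z fz|fy a fa]; first by apply: ly; exists f.
(* If [f] moved a point [a] before [x], an [h] supported between [a] and [x] would have its image
   before that of [f], hence itself be before [f], although [a] precedes its support. *)
apply: contrapT => /not_le_dir ax; have [h h1 hI] := locally_moving_dir lm1 ax.
have /(phi_before h1 f1) hf : before c2 (phi h) (phi f).
  move=> z b hz fb; have [z' hz' zz'] := moves_near_dir c2 hz.
  apply: lt_le_dir zz' _; apply: le_dir_trans (fy _ fb).
  by apply: gy; apply: (below h) hz' => // e /hI[].
have [z hz] := neq1_moves h1; have [az _] := hI _ hz.
exact: lt_dir_irr (lt_dir_trans az (hf _ _ hz fa)).
Qed.

End Transport.

Section Reconstruction.
Context d1 d2 (L1 : chainType d1) (L2 : chainType d2).
Context (G1 : groupClosed (Aut L1)) (G2 : groupClosed (Aut L2)).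
Hypotheses (trans1 : two_interval_transitive G1) (lm1 : locally_moving G1).
Hypotheses (trans2 : two_interval_transitive G2) (lm2 : locally_moving G2).
Variables (alpha : {multiplicative elt G1 -> elt G2}) (beta : elt G2 -> elt G1).
Hypotheses (alphaK : cancel alpha beta) (betaK : cancel beta alpha).

Let alpha1 f : f <> 1 -> alpha f <> 1.
Proof.
by move=> f1 af; apply: f1; apply: (can_inj alphaK); rewrite af multiplicative1.
Qed.

Let beta1 f : f <> 1 -> beta f <> 1.
Proof. by move=> f1 bf; apply: f1; rewrite -[f]betaK bf multiplicative1. Qed.

Let bij : bijective alpha. Proof. by exists beta. Qed.

(** A fixed pair [r], [s] serves as reference: [same_direction] is definable, hence preserved by
    [alpha], and [c] is the direction of the image pair. *)
Lemma alpha_direction : exists c, forall f g, f <> 1 -> g <> 1 ->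
  before true f g <-> before c (alpha f) (alpha g).
Proof.
have [r [s [[r1 s1] rs]]] := exists_before lm1 true.
have : separated_elts (alpha r) (alpha s).
  apply/(separated_elts_isomorphism r s bij).
  by apply/(separated_eltsP trans1 lm1); split => //; exists true.
move=> /(separated_eltsP trans2 lm2)[[ar1 as1] [c ars]]; exists c => f g f1 g1.
have := same_directionP trans1 lm1 f g r1 s1 rs.
have := same_directionP trans2 lm2 (alpha f) (alpha g) ar1 as1 ars.
rewrite -(same_direction_isomorphism f g r s bij) => e2 e1.
split=> h.
  by apply: (e2.1 _).2; apply/e1.
by apply: (e1.1 _).2; apply/e2; split => //; split; exact: alpha1.
Qed.

(** This property determines [tau]. It holds for the map built by transport and for every monotonic
    map inducing [alpha], whence uniqueness. *)
Definition reflects_points c (tau : dedekind L1 -> dedekind L2) :=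
  forall x f, f <> 1 ->
    is_lower true (moves f) x <-> is_lower c (moves (alpha f)) (tau x).

Lemma reflects_points_unique c tau1 tau2 :
  reflects_points c tau1 -> reflects_points c tau2 -> tau1 = tau2.
Proof.
move=> h1 h2; apply/funext => x; apply: (is_lower_inj lm2 (c := c)) => g g1.
by rewrite -[g]betaK -h1 ?h2 //; exact: beta1.
Qed.

Lemma induces_moves (tau : dedekind L1 -> dedekind L2) :
  induces tau alpha -> forall g x, moves (alpha g) (tau x) <-> moves g x.
Proof.
move=> [tau' [tauK tau'K] ind] g x; rewrite /moves /act /= ind /= tauK.
by split=> h e; apply: h; [rewrite e|exact: (can_inj tauK)].
Qed.

Lemma induces_reflects_points (tau : dedekind L1 -> dedekind L2) c :
  (forall x y, le_dir c (tau x) (tau y) = (x <= y)) -> induces tau alpha ->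
  reflects_points c tau.
Proof.
move=> tau_mono ind x f f1; have mE := induces_moves ind.
split=> lx y fy; last by rewrite /le_dir -tau_mono; apply: lx; exact/mE.
have [tau' [tauK tau'K] _] := ind.
rewrite -[y]tau'K tau_mono; apply: lx; apply/mE; by rewrite tau'K.
Qed.

(** A map inducing [alpha] carries supports to supports, so one ordered pair of supports reveals
    whether it preserves or reverses the order. *)
Lemma induces_direction (tau : dedekind L1 -> dedekind L2) c c0 :
  (forall f g, f <> 1 -> g <> 1 ->
    before true f g <-> before c0 (alpha f) (alpha g)) ->
  (forall x y, le_dir c (tau x) (tau y) = (x <= y)) -> induces tau alpha ->
  c = c0.
Proof.
move=> hc0 tau_mono ind; have mE := induces_moves ind.
have [f [g [[f1 g1] fg]]] := exists_before lm1 true.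
have [x fx] := neq1_moves f1; have [y gy] := neq1_moves g1.
have := (hc0 _ _ f1 g1).1 fg _ _ ((mE f x).2 fx) ((mE g y).2 gy).
have := lt_dirW (fg _ _ fx gy); rewrite /le_dir /= -tau_mono.
have [//|cc0 h1 h2] := eqVneq c c0.
have {}h1 : le_dir c0 (tau y) (tau x) by case: (c) (c0) cc0 h1 => -[].
by case: (lt_dir_irr (lt_le_dir h2 h1)).
Qed.

(** Transport along [alpha] and along its inverse gives two mutually inverse maps. Each equality of
    points is tested on the nontrivial elements whose supports the points bound. *)
Lemma reconstruction :
  exists! tau : dedekind L1 -> dedekind L2, monotonic tau /\ induces tau alpha.
Proof.
have [c hc] := alpha_direction.
have /choice[tau tauE] := transport_point lm1 alpha1 hc.
have hc' f g : f <> 1 -> g <> 1 ->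
    before c f g <-> before true (beta f) (beta g).
  by move=> f1 g1; rewrite hc ?betaK //; exact: beta1.
have /choice[tau' tau'E] := transport_point lm2 beta1 hc'.
have tauK : cancel tau tau'.
  move=> x; apply: (is_lower_inj lm1 (c := true)) => f f1.
  by have := tau'E (tau x) _ (alpha1 f1); rewrite alphaK -(tauE x f f1) => <-.
have tau'K : cancel tau' tau.
  move=> y; apply: (is_lower_inj lm2 (c := c)) => g g1.
  by have := tauE (tau' y) _ (beta1 g1); rewrite betaK -(tau'E y g g1) => <-.
have tau_mono x y : le_dir c (tau x) (tau y) = (x <= y).
  apply/idP/idP => xy.
    apply: (is_lower_le lm1 (c := true)) => f f1 /tauE ly.
    apply/tauE => // z fz.
    exact: le_dir_trans xy (ly f1 _ fz).
  apply: (is_lower_le lm2) => g g1 /tau'E; rewrite tauK => ly.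
  by apply/tau'E => // z gz; rewrite tauK; exact: le_trans xy (ly g1 _ gz).
(* Moving the point by [g] amounts to conjugating the tested element by [g^-1], and [alpha] respects
   conjugation. *)
have tau_act g x : act (alpha g) (tau x) = tau (act g x).
  apply: (is_lower_inj lm2 (c := c)) => h h1; rewrite -[h]betaK.
  have b1 := beta1 h1; rewrite -tauE //.
  have := is_lower_conj true g^-1 (beta h) x.
  have := is_lower_conj c (alpha g)^-1 (alpha (beta h)) (tau x).
  rewrite !invgK => <- <-; rewrite tauE; last first.
    by have := @conj_neq1 _ _ _ g^-1 (beta h) b1; rewrite invgK.
  by rewrite !gmulfM multiplicativeV.
have tau_ind : induces tau alpha.
  exists tau' => // g; apply/funext => y /=.
  by rewrite -[X in _ = tau X]/(act g (tau' y)) -tau_act tau'K.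
exists tau; split.
  split => //; rewrite /monotonic.
  by case: (c) tau_mono => h; [left|right] => x y; exact: h.
move=> tau2 [mono2 ind2].
have [c' tau2_mono] : exists c',
    forall x y, le_dir c' (tau2 x) (tau2 y) = (x <= y).
  by case: mono2 => h; [exists true|exists false] => x y; exact: h.
have cc := induces_direction hc tau2_mono ind2; subst c'.
exact: (reflects_points_unique tauE (induces_reflects_points tau2_mono ind2)).
Qed.

End Reconstruction.

Theorem theorem7p6 (d1 d2 : Order.disp_t) (L1 : chainType d1) (L2 : chainType d2)
    (G1 : groupClosed (Aut L1)) (G2 : groupClosed (Aut L2))
    (trans1 : two_interval_transitive G1) (trans2 : two_interval_transitive G2)
    (bdd1 : has_bounded_element G1) (bdd2 : has_bounded_element G2) :
  (elem_equiv (group_structure (elt G1)) (group_structure (elt G2)) ->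
   elem_equiv (ACT_EP G1) (ACT_EP G2)) /\
  (forall alpha : {multiplicative elt G1 -> elt G2}, bijective alpha ->
   exists! tau : dedekind L1 -> dedekind L2,
     monotonic tau /\ induces tau alpha).
Proof.
have lm1 := transitive_locally_moving trans1 bdd1.
have lm2 := transitive_locally_moving trans2 bdd2.
split; first exact: elem_equiv_ACT_EP.
by move=> alpha [beta alphaK betaK]; exact: reconstruction alphaK betaK.
Qed.
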